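(* The conditional real numbers $(\mathbf{R},+,\cdot,\leqslant)$ form a conditionally ordered field. Moreover, $(\mathbf{Q},+,\cdot,\leqslant)$ is isomorphic to a conditionally ordered subfield of $(\mathbf{R},+,\cdot,\leqslant)$.
   Context: $\mathcal{A}$ is a complete Boolean algebra with $0\ne1$; $p(a)$ is the set of families $(a_i)$ with $\bigvee a_i=a$, $a_i\wedge a_j=0$ ($i\neq j$). A conditional set $X=(X_a,\gamma_a)_{a\in\mathcal{A}}$ consists of sets and surjections $\gamma_a:X_1\to X_a$ ($X_0$ a singleton, $\gamma_1=\mathrm{id}$), consistent and stable (for $(a_i)\in p(1)$, $x_i\in X_{a_i}$ there is a unique $x=\sum a_ix_i\in X_1$ with $\gamma_{a_i}(x)=x_i$); $ax:=\gamma_a(x)$. Conditional functions are families $f_a:X_a\to Y_a$ with $f_a(ax)=af_1(x)$; a conditional binary operation on $X$ is a conditional function $X\times X\to X$ (products taken componentwise). A conditional ring is a conditional set with conditional operations $+,\cdot$ such that $(X_1,+,\cdot)$ is a ring; it is a conditional field if for every $x\in X_1$ with $ax\ne a0$ for all $a>0$ there is $y$ with $xy=yx=1$. A conditional partial order is a conditional relation (a conditional subset of $X\times X$ living on $1$) whose primal set is a partial order on $X_1$; $x<y$ means $x\leqslant y$ and ($ax=ay\Rightarrow a=0$); it is a conditional total order if for all $x,y$ there is $(a,b,c)\in p(1)$ with $ax<ay$, $by<bx$, $cx=cy$ (inequalities in the restriction to the respective condition). A conditionally ordered field is a conditional field with a conditional total order such that $x<y$ implies $x+z<y+z$, and $x,y>0$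 implies $xy>0$. $\mathbf{Q}$ (resp. $\mathbf{N}$) is the conditional set generated by $\mathbb{Q}$ (resp. $\mathbb{N}$): elements of $\mathbf{Q}_a$ are formal sums $\sum a_iq_i$, $(a_i)\in p(a)$, $q_i\in\mathbb{Q}$, identified when $\bigvee\{a_i:q_i=z\}$ agree for all $z$, with $\gamma_a(\sum a_iq_i)=\sum(a\wedge a_i)q_i$; operations and order are defined piecewise ($\sum a_iq_i\leqslant\sum b_jp_j$ iff $q_i\le p_j$ whenever $a_i\wedge b_j\ne0$); $|q|=\max\{q,-q\}$; $\mathbf{Q}_{++}=\{q>0\}$. A conditional sequence $(q_n)$ in $\mathbf Q$ is a conditional function $\mathbf{N}\to\mathbf{Q}$; it is conditionally Cauchy if for every $\varepsilon\in\mathbf{Q}_{++}$ there is $n_0\in\mathbf{N}$ with $|q_n-q_m|<\varepsilon$ for all $m,n\geqslant n_0$. Two conditional Cauchy sequences are equivalent, $(q_n)\sim(p_n)$, if for every $\varepsilon\in\mathbf{Q}_{++}$ there is $n_0$ with $|q_n-p_n|<\varepsilon$ for $n\geqslant n_0$. $\mathbf{R}$ is the conditional set of equivalence classes (built componentwise on each restriction $a\mathbf{Q}$), with $[(q_n)]+[(p_n)]=[(q_n+p_n)]$, $[(q_n)][(p_n)]=[(q_np_n)]$, and $[(p_n)]\leqslant[(q_n)]$ iff for every $\varepsilon\in\mathbf{Q}_{++}$ there is $n_0$ with $q_n-p_n>-\varepsilon$ for all $n\geqslant n_0$. An isomorphism onto a conditionally ordered subfield means a conditionally injective conditional function preserving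 $+$, $\cdot$ and $\leqslant$ whose image is a conditional subfield. *)

(* Defs.v *)
From mathcomp Require Import all_boot all_order all_algebra.
From mathcomp Require Import all_classical.

Set Implicit Arguments.
Unset Strict Implicit.
Unset Printing Implicit Defensive.

Import Order.TTheory GRing.Theory Num.Theory.

Local Open Scope classical_set_scope.
Local Open Scope order_scope.

Section ConditionalSets.
Context {d : Order.disp_t} (A : ctbDistrLatticeType d).

Definition order_complete : Prop := forall S : set A, supremums S !=set0.

Definition partition_of (a : A) (I : Type) (s : I -> A) : Prop :=
  supremums (range s) a /\ forall i j, i <> j -> Order.meet (s i) (s j) = \bot.

(* The sets X_a are subsets of one ambient type, and gam a is a function on
   that type; only the values of gam a on X_1 matter. *)
Record condData := CondData {
  carrier : Type;
  elts :> A -> set carrier;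
  gam : A -> carrier -> carrier
}.
Arguments gam : clear implicits.

Record is_condSet (X : condData) : Prop := {
  condSet_bot : exists x, X \bot = [set x];
  condSet_gam_fun : forall a, set_fun (X \top) (X a) (gam X a);
  condSet_gam_surj : forall a, set_surj (X \top) (X a) (gam X a);
  condSet_gam_top : forall x, X \top x -> gam X \top x = x;
  condSet_consistent : forall (a b : A) x y, X \top x -> X \top y ->
    b <= a -> gam X a x = gam X a y -> gam X b x = gam X b y;
  condSet_stable : forall (I : Type) (s : I -> A) (x : I -> carrier X),
    partition_of \top s -> (forall i, X (s i) (x i)) ->
    exists! z, X \top z /\ forall i, gam X (s i) z = x i
}.

(* For x in X_a and b <= a: y is the restriction b x of x, that is, the image
   of x under the map X_a -> X_b through which gam b factors. *)
Definition restricts (X : condData) (a b : A) (x y : carrier X) : Prop :=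
  exists2 z, X \top z & gam X a z = x /\ gam X b z = y.

Definition is_condfun (X Y : condData)
    (f : A -> carrier X -> carrier Y) : Prop :=
  (forall a, set_fun (X a) (Y a) (f a)) /\
  (forall a x, X \top x -> f a (gam X a x) = gam Y a (f \top x)).

(* Conditional functions a X -> a Y between the restrictions to a, which are
   conditional sets over the relative algebra of the b <= a. Values of f at
   conditions b that are not below a are junk. *)
Definition is_condfun_on (a : A) (X Y : condData)
    (f : A -> carrier X -> carrier Y) : Prop :=
  (forall b, b <= a -> set_fun (X b) (Y b) (f b)) /\
  (forall b x y, b <= a -> X a x ->
     restricts a b x y -> restricts a b (f a x) (f b y)).

Definition condProd (X Y : condData) : condData :=
  CondData (fun a => X a `*` Y a) (fun a z => (gam X a z.1, gam Y a z.2)).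

Definition condRestr (X : condData) (S : A -> set (carrier X)) : condData :=
  CondData S (gam X).

(* Conditional subsets living on 1 *)
Definition is_condSubset (X : condData) (S : A -> set (carrier X)) : Prop :=
  (forall a, S a `<=` X a) /\ is_condSet (condRestr S).

Definition condOp (X : condData) : Type :=
  A -> carrier X -> carrier X -> carrier X.

Definition is_condOp (X : condData) (op : condOp X) : Prop :=
  @is_condfun (condProd X X) X (fun a z => op a z.1 z.2).

Definition condRel (X : condData) : Type := A -> set (carrier X * carrier X).

Definition is_condRel (X : condData) (le : condRel X) : Prop :=
  @is_condSubset (condProd X X) le.

Definition is_condPartialOrder (X : condData) (le : condRel X) : Prop :=
  [/\ is_condRel le,
      forall x, X \top x -> le \top (x, x),
      forall x y, le \top (x, y) -> le \top (y, x) -> x = y &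
      forall x y z, le \top (x, y) -> le \top (y, z) -> le \top (x, z)].

(* The strict order of the restriction a X, for x and y in X_a *)
Definition condLt (X : condData) (le : condRel X) (a : A)
    (x y : carrier X) : Prop :=
  le a (x, y) /\
  forall b w, b <= a -> restricts a b x w -> restricts a b y w -> b = \bot.

Definition is_condTotalOrder (X : condData) (le : condRel X) : Prop :=
  is_condPartialOrder le /\
  forall x y, X \top x -> X \top y -> exists a b c : A,
    [/\ partition_of \top (tnth [tuple a; b; c]),
        condLt le a (gam X a x) (gam X a y),
        condLt le b (gam X b y) (gam X b x) &
        gam X c x = gam X c y].

Record is_condRing (X : condData) (add mul : condOp X)
    (zero one : carrier X) : Prop := {
  condRing_set : is_condSet X;
  condRing_add : is_condOp add;
  condRing_mul : is_condOp mul;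
  condRing_zero : X \top zero;
  condRing_one : X \top one;
  condRing_addA : forall x y z, X \top x -> X \top y -> X \top z ->
    add \top x (add \top y z) = add \top (add \top x y) z;
  condRing_addC : forall x y, X \top x -> X \top y ->
    add \top x y = add \top y x;
  condRing_add0 : forall x, X \top x -> add \top zero x = x;
  condRing_addN : forall x, X \top x ->
    exists2 y, X \top y & add \top y x = zero;
  condRing_mulA : forall x y z, X \top x -> X \top y -> X \top z ->
    mul \top x (mul \top y z) = mul \top (mul \top x y) z;
  condRing_mul1l : forall x, X \top x -> mul \top one x = x;
  condRing_mul1r : forall x, X \top x -> mul \top x one = x;
  condRing_mulDl : forall x y z, X \top x -> X \top y -> X \top z ->
    mul \top (add \top x y) z = add \top (mul \top x z) (mul \top y z);
  condRing_mulDr : forall x y z, X \top x -> X \top y -> X \top z ->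
    mul \top x (add \top y z) = add \top (mul \top x y) (mul \top x z)
}.

(* Neither commutativity of mul nor zero <> one is part of the definition. *)
Definition is_condField (X : condData) (add mul : condOp X)
    (zero one : carrier X) : Prop :=
  is_condRing add mul zero one /\
  forall x, X \top x ->
    (forall a, \bot < a -> gam X a x <> gam X a zero) ->
    exists2 y, X \top y & mul \top x y = one /\ mul \top y x = one.

Record is_condOrderedField (X : condData) (add mul : condOp X)
    (zero one : carrier X) (le : condRel X) : Prop := {
  condOrderedField_field : is_condField add mul zero one;
  condOrderedField_order : is_condTotalOrder le;
  condOrderedField_add : forall x y z, X \top x -> X \top y -> X \top z ->
    condLt le \top x y -> condLt le \top (add \top x z) (add \top y z);
  condOrderedField_mul : forall x y, X \top x -> X \top y ->
    condLt le \top zero x -> condLt le \top zero y ->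
    condLt le \top zero (mul \top x y)
}.

(* A subfield has the zero and the one of the ambient field. *)
Definition is_condOrderedSubfield (X : condData) (add mul : condOp X)
    (zero one : carrier X) (le : condRel X) (S : A -> set (carrier X)) : Prop :=
  is_condSubset S /\
  @is_condOrderedField (condRestr S) add mul zero one
    (fun a => le a `&` (S a `*` S a)).

Record is_isoOntoSubfield (X : condData) (addX mulX : condOp X)
    (leX : condRel X) (Y : condData) (addY mulY : condOp Y)
    (zeroY oneY : carrier Y) (leY : condRel Y)
    (f : A -> carrier X -> carrier Y) : Prop := {
  iso_fun : is_condfun f;
  iso_inj : forall a, set_inj (X a) (f a);
  iso_add : forall a x y, X a x -> X a y ->
    f a (addX a x y) = addY a (f a x) (f a y);
  iso_mul : forall a x y, X a x -> X a y ->
    f a (mulX a x y) = mulY a (f a x) (f a y);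
  iso_le : forall a x y, X a x -> X a y ->
    leX a (x, y) <-> leY a (f a x, f a y);
  iso_image :
    is_condOrderedSubfield addY mulY zeroY oneY leY (fun a => f a @` X a)
}.

End ConditionalSets.

(* Operations and relations on equivalence classes are given by unions over all
   representatives; a union over the representatives of given classes is a
   class if and only if the operation does not depend on representatives. *)

Section GeneratedSets.
Context {d : Order.disp_t} (A : ctbDistrLatticeType d).

(* Formal families (a_i, x_i), not yet required to be a partition *)
Record formalSum (E : Type) := FormalSum {
  fs_index : Type;
  fs_cond : fs_index -> A;
  fs_val : fs_index -> E
}.

Definition fs_at (E : Type) (s : formalSum E) (z : E) : A :=
  supremum \bot [set fs_cond i | i in [set i | @fs_val E s i = z]].

Definition fs_eq (E : Type) (s t : formalSum E) : Prop :=
  forall z, fs_at s z = fs_at t z.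

Definition gen_class (E : Type) (a : A) (s : formalSum E) : set (formalSum E) :=
  [set t | partition_of a (@fs_cond E t) /\ fs_eq s t].

Definition gen_elts (E : Type) (a : A) : set (set (formalSum E)) :=
  [set gen_class a s | s in [set s | partition_of a (@fs_cond E s)]].

Definition fs_restr (E : Type) (a : A) (s : formalSum E) : formalSum E :=
  FormalSum (fun i => Order.meet a (@fs_cond E s i)) (@fs_val E s).

Definition fs_map (E F : Type) (f : E -> F) (s : formalSum E) : formalSum F :=
  FormalSum (@fs_cond E s) (fun i => f (fs_val i)).

Definition fs_map2 (E F G : Type) (f : E -> F -> G)
    (s : formalSum E) (t : formalSum F) : formalSum G :=
  FormalSum (fun ij : fs_index s * fs_index t =>
               Order.meet (fs_cond ij.1) (fs_cond ij.2))
            (fun ij => f (fs_val ij.1) (fs_val ij.2)).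

Definition fs_rel (E F : Type) (r : E -> F -> Prop)
    (s : formalSum E) (t : formalSum F) : Prop :=
  forall i j, Order.meet (@fs_cond E s i) (@fs_cond F t j) != \bot ->
    r (fs_val i) (fs_val j).

(* The conditional set generated by E *)
Definition condGen (E : Type) : condData A :=
  CondData (@gen_elts E)
    (fun a x => \bigcup_(s in x) gen_class a (fs_restr a s)).

Definition gen_const (E : Type) (a : A) (z : E) : carrier (condGen E) :=
  gen_class a (FormalSum (fun _ : unit => a) (fun=> z)).

Definition gen_map (E F : Type) (f : E -> F) (a : A)
    (x : carrier (condGen E)) : carrier (condGen F) :=
  \bigcup_(s in x) gen_class a (fs_map f s).

Definition gen_map2 (E F G : Type) (f : E -> F -> G) (a : A)
    (x : carrier (condGen E)) (y : carrier (condGen F)) :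
    carrier (condGen G) :=
  \bigcup_(s in x) \bigcup_(t in y) gen_class a (fs_map2 f s t).

Definition gen_rel (E : Type) (r : E -> E -> Prop) : condRel (condGen E) :=
  fun a => [set z | [/\ gen_elts a z.1, gen_elts a z.2 &
    exists2 s, z.1 s & exists2 t, z.2 t & fs_rel r s t]].

End GeneratedSets.

Section ConditionalReals.
Context {d : Order.disp_t} (A : ctbDistrLatticeType d).

Definition condNat : condData A := condGen A nat.
Definition condRat : condData A := condGen A rat.

Definition nle : condRel condNat := gen_rel (fun m n : nat => (m <= n)%N).

Definition qle : condRel condRat := gen_rel (fun x y : rat => (x <= y)%R).
Definition qlt := condLt qle.

Definition qadd : condOp condRat := gen_map2 (fun x y : rat => (x + y)%R).
Definition qmul : condOp condRat := gen_map2 (fun x y : rat => (x * y)%R).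
Definition qmax : condOp condRat := gen_map2 (fun x y : rat => Num.max x y).
Definition qopp : A -> carrier condRat -> carrier condRat :=
  gen_map (fun x : rat => (- x)%R).
Definition qsub : condOp condRat := fun a x y => qadd a x (qopp a y).
Definition qabs (a : A) (x : carrier condRat) : carrier condRat :=
  qmax a x (qopp a x).

(* The positive elements of Q_a *)
Definition qpos (a : A) : set (carrier condRat) :=
  [set x | condRat a x /\ qlt a (gen_const a 0%R) x].

(* A sequence a N -> a Q is a family (q_b) with junk values unless b <= a, so
   that the restriction of q to b <= a is q itself, seen as a sequence on b. *)
Definition qseq : Type := A -> carrier condNat -> carrier condRat.

Definition condCauchy (a : A) (q : qseq) : Prop :=
  @is_condfun_on d A a condNat condRat q /\
  forall eps, qpos a eps -> exists2 n0, condNat a n0 &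
    forall m n, condNat a m -> condNat a n ->
      nle a (n0, m) -> nle a (n0, n) ->
      qlt a (qabs a (qsub a (q a n) (q a m))) eps.

Definition qseq_equiv (a : A) (q p : qseq) : Prop :=
  forall eps, qpos a eps -> exists2 n0, condNat a n0 &
    forall n, condNat a n -> nle a (n0, n) ->
      qlt a (qabs a (qsub a (q a n) (p a n))) eps.

Definition real_class (a : A) (q : qseq) : set qseq :=
  [set p | condCauchy a p /\ qseq_equiv a q p].

Definition real_elts (a : A) : set (set qseq) :=
  [set real_class a q | q in condCauchy a].

Definition condReal : condData A :=
  CondData real_elts (fun a x => \bigcup_(q in x) real_class a q).

Definition qseq_add (q p : qseq) : qseq := fun b n => qadd b (q b n) (p b n).
Definition qseq_mul (q p : qseq) : qseq := fun b n => qmul b (q b n) (p b n).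
Definition qseq_const (z : rat) : qseq := fun b _ => gen_const b z.

Definition radd : condOp condReal := fun a x y =>
  \bigcup_(q in x) \bigcup_(p in y) real_class a (qseq_add q p).
Definition rmul : condOp condReal := fun a x y =>
  \bigcup_(q in x) \bigcup_(p in y) real_class a (qseq_mul q p).

Definition rzero : carrier condReal := real_class \top (qseq_const 0%R).
Definition rone : carrier condReal := real_class \top (qseq_const 1%R).

Definition qseq_le (a : A) (p q : qseq) : Prop :=
  forall eps, qpos a eps -> exists2 n0, condNat a n0 &
    forall n, condNat a n -> nle a (n0, n) ->
      qlt a (qopp a eps) (qsub a (q a n) (p a n)).

Definition rle : condRel condReal := fun a =>
  [set z | [/\ real_elts a z.1, real_elts a z.2 &
    exists2 p, z.1 p & exists2 q, z.2 q & qseq_le a p q]].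

End ConditionalReals.

Arguments condNat {d} A.
Arguments condRat {d} A.
Arguments condReal {d} A.
Arguments qadd {d} A.
Arguments qmul {d} A.
Arguments qle {d} A.
Arguments radd {d} A.
Arguments rmul {d} A.
Arguments rle {d} A.
Arguments rzero {d} A.
Arguments rone {d} A.

(* Main.v *)
(** The argument is forcing over [A].  On a dense set of nonzero conditions an
    element of the conditional set generated by [E] takes a single standard
    value, and two elements are equal as soon as they take equal values on
    every common condition.  A conditional sequence is thus given by the
    conditions on which its [k]-th term ([k] a standard natural number) takes
    a rational value [z].  Because the [eps] and the [n0] in the definitions
    of Cauchy sequence, equivalence and order can be mixed along a partition,
    each of these notions amounts to: for every standard rational [e > 0],
    below every nonzero condition there are a nonzero condition and a standard
    [k] with the required bound from [k] on.  The field and order axioms then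
    follow from the classical epsilon arguments run below a condition that
    decides the finitely many values involved.  Invertibility and totality
    rest on one dichotomy: two Cauchy sequences are either equivalent on a
    condition, or some smaller nonzero condition separates them by a fixed
    rational with a fixed sign. *)
Require Import Defs.
From mathcomp Require Import all_boot all_order all_algebra.
From mathcomp Require Import all_classical.
From mathcomp Require Import ring lra.

Set Implicit Arguments.
Unset Strict Implicit.
Unset Printing Implicit Defensive.

Import Order.Theory GRing.Theory Num.Theory.

Section ConditionalReals.
Local Open Scope classical_set_scope.
Local Open Scope order_scope.
Context {d : Order.disp_t} (A : ctbDistrLatticeType d).
Context (Acomplete : order_complete A).
Implicit Types (a b c : A).

(** * Density in a complete Boolean algebra *)

Implicit Types (S : set A).

(** The obstacle is that no nonzero condition need decide all terms of a sequence: the algebra may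
    be atomless, and infinitely many decisions cannot in general be met below one nonzero condition.
    A bound on a tail is therefore never stated for known values, but for every smaller condition on
    which the terms in question happen to take given values ([holds_from], [cauchy_from]). Such
    statements pass to smaller conditions and are local, that is, true as soon as they are true
    densely; these two properties are what allows conditional [eps] and [n0] to be exchanged for
    standard ones. When a conditional index is built, its pieces are made disjoint by keeping the
    least possible standard index, so the well-order of the natural numbers replaces a maximal
    antichain. Bounds and indices may vary with the condition. This is why an element that vanishes
    on no nonzero condition has an inverse even when no single standard rational keeps it away from
    zero. *)

Definition dense a (P : A -> Prop) : Prop :=
  forall b, \bot < b -> b <= a -> exists c, [/\ \bot < c, c <= b & P c].

(** Separativity: if [a] is not below [b], nothing nonzero below the difference of [a] and [b] lies
    below [b]. Inequalities between suprema thus become tests on small conditions. *)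
Lemma le_dense a b : dense a (fun c => c <= b) -> a <= b.
Proof.
move=> ab; apply: contrapT => /negP nab.
have : \bot < a `\` b.
  by rewrite lt0x; apply: contra nab => /eqP E; rewrite -[a](joinIB b) E joinx0 leIr.
move=> /ab/(_ (leBx _ _))[c [c0 cab cb]].
have : c <= b `&` (a `\` b) by rewrite lexI cb.
by rewrite diffKI lex0 => /eqP cE; rewrite cE ltxx in c0.
Qed.

Lemma dense_sub a b P : b <= a -> dense a P -> dense b P.
Proof. by move=> ba aP c c0 cb; apply: aP => //; exact: le_trans ba. Qed.

Lemma dense_imp a (P Q : A -> Prop) :
  (forall b, \bot < b -> b <= a -> P b -> Q b) -> dense a P -> dense a Q.
Proof.
move=> PQ aP b b0 ba; have [c [c0 cb Pc]] := aP b b0 ba.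
by exists c; split=> //; apply: PQ => //; exact: le_trans ba.
Qed.

Lemma dense_bind a (P Q : A -> Prop) :
  (forall b, \bot < b -> b <= a -> P b -> dense b Q) -> dense a P -> dense a Q.
Proof.
move=> PQ aP b b0 ba; have [c [c0 cb Pc]] := aP b b0 ba.
have [e [e0 ec Qe]] := PQ c c0 (le_trans cb ba) Pc c c0 (lexx _).
by exists e; split=> //; exact: le_trans cb.
Qed.

Lemma dense_all a (P : A -> Prop) : (forall b, \bot < b -> b <= a -> P b) -> dense a P.
Proof. by move=> aP b b0 ba; exists b; split=> //; exact: aP. Qed.

Definition sup S : A := supremum \bot S.

Lemma sup_supremums S : supremums S (sup S).
Proof.
rewrite /sup /supremum; case: ifPn => [/eqP -> | _].
  (* The default value [\bot] is the correct supremum of the empty set. *)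
  by split=> [x []|x _]; exact: le0x.
by have [x Sx] := Acomplete S; case: xgetP => [y _ //|/(_ x)].
Qed.

Lemma le_sup S a : S a -> a <= sup S.
Proof. by move=> Sa; have [+ _] := sup_supremums S; exact. Qed.

Lemma sup_le S a : (forall b, S b -> b <= a) -> sup S <= a.
Proof. by move=> Sa; have [_] := sup_supremums S; apply. Qed.

(** If no nonzero part of [b] lies below an element of [S], then the complement of [b] bounds [S],
    hence also [a], and [b] is disjoint from itself. *)
Lemma supremums_dense S a : supremums S a <->
  (forall b, S b -> b <= a) /\ dense a (fun c => exists2 b, S b & c <= b).
Proof.
split=> [[ub lub]|[ub Sd]].
  split=> // b b0 ba; apply: contrapT => nb.
  have bS x : S x -> x <= ~` b.
    move=> Sx; apply: contrapT => xb; apply: nb; exists (b `&` x).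
    split; [|exact: leIl|by exists x; rewrite ?leIr].
    rewrite lt0x; apply/negP => /eqP bx; apply: xb.
    by rewrite -disj_leC meetC bx.
  have : b <= ~` b by apply: le_trans ba _; exact: lub.
  move=> bb; have : b <= b `&` ~` b by rewrite lexI lexx.
  by rewrite meetxC lex0 => /eqP bE; rewrite bE ltxx in b0.
split=> // x Sx; apply: le_dense => b b0 ba.
have [c [c0 cb [y Sy cy]]] := Sd b b0 ba.
by exists c; split=> //; apply: le_trans (Sx y Sy).
Qed.

Lemma le_sup_dense S a : a <= sup S -> dense a (fun c => exists2 b, S b & c <= b).
Proof.
move=> aS; have /supremums_dense[_ /(dense_sub aS)] := sup_supremums S; exact.
Qed.

(** * Partitions *)

(** A partition is read as a name for an element of [I]: small enough conditions decide it, and no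
    nonzero condition decides it in two ways. Pieces may be [\bot], so uniqueness speaks of nonzero
    conditions only. *)
Lemma partitionP a (I : Type) (s : I -> A) : partition_of a s <->
  [/\ forall i, s i <= a, dense a (fun c => exists i, c <= s i) &
      forall c i j, \bot < c -> c <= s i -> c <= s j -> i = j].
Proof.
split=> [[/supremums_dense[sa sd] disj]|[sa sd disj]].
  split=> [i|b b0 ba|c i j c0 ci cj].
  - by apply: sa; exists i.
  - by have [c [c0 cb [_ [i _ <-] ci]]] := sd b b0 ba; exists c; split=> //; exists i.
  - apply: contrapT => /disj ij; have : c <= s i `&` s j by rewrite lexI ci.
    by rewrite ij lex0 => /eqP cE; rewrite cE ltxx in c0.
split.
  apply/supremums_dense; split=> [_ [i _ <-] //|b b0 ba].
  have [c [c0 cb [i ci]]] := sd b b0 ba.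
  by exists c; split=> //; exists (s i) => //; exists i.
move=> i j ij; apply/eqP; apply/negPn/negP; rewrite -lt0x => m0; apply: ij.
by apply: (disj _ i j m0); [exact: leIl|exact: leIr].
Qed.

Section PartitionTheory.
Context (a : A) (I : Type) (s : I -> A) (part : partition_of a s).

Lemma part_le i : s i <= a.
Proof. by have /partitionP[] := part. Qed.

Lemma part_dense : dense a (fun c => exists i, c <= s i).
Proof. by have /partitionP[] := part. Qed.

Lemma part_decide b : \bot < b -> b <= a ->
  exists i c, [/\ \bot < c, c <= b & c <= s i].
Proof.
by move=> b0 ba; have [c [c0 cb [i ci]]] := part_dense b0 ba; exists i, c.
Qed.

Lemma part_uniq c i j : \bot < c -> c <= s i -> c <= s j -> i = j.
Proof. by have /partitionP[_ _] := part; apply. Qed.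

Lemma part_restr b : b <= a -> partition_of b (fun i => b `&` s i).
Proof.
move=> ba; apply/partitionP; split=> [i|c c0 cb|c i j c0].
- exact: leIl.
- have [e [e0 ec [i ei]]] := part_dense c0 (le_trans cb ba).
  by exists e; split=> //; exists i; rewrite lexI ei (le_trans ec cb).
- by rewrite !lexI => /andP[_ ci] /andP[_ cj]; apply: part_uniq cj.
Qed.

(** Agreement is asked only where both indices are decided; below a piece of one partition, density
    of the conditions deciding the other supplies the rest. *)
Lemma part_ext (t : I -> A) : partition_of a t ->
  (forall c i j, \bot < c -> c <= s i -> c <= t j -> i = j) -> s = t.
Proof.
move=> partt st; apply/funext => i; apply/le_anti/andP; split.
- apply: le_dense => b b0 bs; have /partitionP[_ td _] := partt.
  have [c [c0 cb [j cj]]] := td b b0 (le_trans bs (part_le i)).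
  by exists c; rewrite (st c i j c0 (le_trans cb bs) cj); split.
- apply: le_dense => b b0 bt; have /partitionP[ta _ _] := partt.
  have [c [c0 cb [j cj]]] := part_dense b0 (le_trans bt (ta i)).
  by exists c; rewrite -(st c j i c0 cj (le_trans cb bt)); split.
Qed.

End PartitionTheory.

Lemma dense_partition a (I : Type) (s : I -> A) (P : A -> Prop) :
  partition_of a s -> (forall i, dense (s i) P) -> dense a P.
Proof.
move=> part sP b b0 ba; have [i [c [c0 cb ci]]] := part_decide part b0 ba.
have [e [e0 ec Pe]] := sP i c c0 ci; exists e; split=> //; exact: le_trans cb.
Qed.

(** The mixture of the names [f i]. The partition itself does not occur, because each [f i] is meant
    to lie below its own piece. *)
Definition glue (I E : Type) (f : I -> E -> A) (z : E) : A :=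
  sup [set f i z | i in [set: I]].

Lemma le_glue (I E : Type) (f : I -> E -> A) c i z : c <= f i z -> c <= glue f z.
Proof. by move=> cf; apply: le_trans cf _; apply: le_sup => //; exists i. Qed.

Lemma glue_dense (I E : Type) (f : I -> E -> A) c z :
  c <= glue f z -> dense c (fun b => exists i, b <= f i z).
Proof.
move=> /le_sup_dense; apply: dense_imp => b b0 bc.
by move=> [_ [i _ <-] bi]; exists i.
Qed.

(** Below [s i] only the index [i] contributes, since [f j z] lies below [s j]. So the mixture
    restricts to the prescribed names. *)
Lemma glue_restr a (I E : Type) (s : I -> A) (f : I -> E -> A) i z :
  partition_of a s -> (forall i, partition_of (s i) (f i)) ->
  s i `&` glue f z = f i z.
Proof.
move=> parts partf; apply/le_anti/andP; split.
  apply: le_dense => b b0; rewrite lexI => /andP[bs bg].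
  have [c [c0 cb [j cj]]] := glue_dense bg b0 (lexx _).
  have cs := le_trans cj (part_le (partf j) z).
  by exists c; rewrite (part_uniq parts c0 (le_trans cb bs) cs); split.
by rewrite lexI (part_le (partf i)) /= (le_glue (lexx (f i z))).
Qed.

Lemma part_glue a (I E : Type) (s : I -> A) (f : I -> E -> A) :
  partition_of a s -> (forall i, partition_of (s i) (f i)) ->
  partition_of a (glue f).
Proof.
move=> parts partf; apply/partitionP; split=> [z|b b0 ba|c z w c0 cz cw].
- apply: sup_le => // _ [i _ <-].
  exact: le_trans (part_le (partf i) z) (part_le parts i).
- have [i [c [c0 cb ci]]] := part_decide parts b0 ba.
  have [z [e [e0 ec ez]]] := part_decide (partf i) c0 ci.
  exists e; split=> //; first exact: le_trans cb.
  by exists z; exact: le_glue ez.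
- have [b [b0 bc [i bi]]] := glue_dense cz c0 (lexx _).
  have bs := le_trans bi (part_le (partf i) z).
  apply: (part_uniq (partf i) b0 bi).
  by rewrite -(glue_restr i w parts partf) lexI bs (le_trans bc).
Qed.

(** Serves to extend an object living on [a] to [\top], with an arbitrary default on the
    complement. *)
Lemma part_compl a : partition_of \top (fun b : bool => if b then a else ~` a).
Proof.
apply/partitionP; split=> [i|b b0 _|c]; first exact: lex1.
  have [ba|ba] := eqVneq (b `&` a) \bot.
    exists b; split=> //; exists false.
    by rewrite -disj_leC ba.
  exists (b `&` a); split; [by rewrite lt0x|exact: leIl|by exists true; exact: leIr].
have no : \bot < c -> c <= a -> c <= ~` a -> False.
  move=> c0 ca nca; have : c <= a `&` ~` a by rewrite lexI ca.
  by rewrite meetxC lex0 => /eqP cE; rewrite cE ltxx in c0.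
by move=> [] [] // c0 c1 c2; case: no.
Qed.

(** * Conditional subsets and ordered subfields *)

Lemma condProd_set (X Y : condData A) : is_condSet X -> is_condSet Y ->
  is_condSet (condProd X Y).
Proof.
move=> sX sY; split.
- have [x Xx] := condSet_bot sX; have [y Yy] := condSet_bot sY; exists (x, y).
  by apply/seteqP; split=> -[x' y'] /=; rewrite Xx Yy => -[-> ->].
- by move=> a [x y] [Xx Yy]; split; exact: condSet_gam_fun.
- move=> a [x y] [/= Xx Yy].
  have [x' Xx' <-] := condSet_gam_surj sX Xx;
    have [y' Yy' <-] := condSet_gam_surj sY Yy.
  by exists (x', y').
- by move=> [x y] [/= Xx Yy]; rewrite (condSet_gam_top sX) // (condSet_gam_top sY).
- move=> a b [x y] [x' y'] [/= Xx Yy] [/= Xx' Yy'] ba [xx yy].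
  congr pair; [exact: (condSet_consistent sX _ _ ba)|exact: (condSet_consistent sY _
    _ ba)].
- move=> I s x ps xs.
  have [x' [[Xx x'E] x'u]] := condSet_stable sX ps (fun i => (xs i).1).
  have [y' [[Yy y'E] y'u]] := condSet_stable sY ps (fun i => (xs i).2).
  exists (x', y'); split; first by split=> // i; rewrite /= x'E y'E -surjective_pairing.
  move=> [u v] [[/= Xu Yv] uv]; congr pair.
    by apply: x'u; split=> // i; rewrite -uv.
  by apply: y'u; split=> // i; rewrite -uv.
Qed.

(** Stability up to restriction and gluing suffice. Surjectivity follows by extending an element
    over [a] with [x0] on the complement, the extension lying in [S] by locality; [x0] also supplies
    the element at [\bot]. *)
Lemma condSubset_local (X : condData A) (S : A -> set (carrier X)) x0 :
  is_condSet X -> (forall a, S a `<=` X a) -> S \top x0 ->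
  (forall a x, S \top x -> S a (gam a x)) ->
  (forall (I : Type) (s : I -> A) z, partition_of \top s -> X \top z ->
    (forall i, S (s i) (gam (s i) z)) -> S \top z) ->
  is_condSubset S.
Proof.
move=> sX SX Sx0 Sgam Sloc; split=> //; split=> /=.
- have [x Xx] := condSet_bot sX; exists x; apply/seteqP; split=> y Sy.
    by have := SX _ _ Sy; rewrite Xx.
  have := Sgam \bot _ Sx0; move: (SX _ _ (Sgam \bot _ Sx0)); rewrite Xx => -> .
  by rewrite Sy.
- exact: Sgam.
- move=> a y Sy.
  pose f (i : bool) := if i then y else gam (~` a) x0.
  have [|z [[Xz zE] _]] := condSet_stable sX (part_compl a) (x := f).
    by case; [exact: SX|exact: (condSet_gam_fun sX _ (SX _ _ Sx0))].
  exists z; last exact: zE true.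
  apply: Sloc (part_compl a) Xz _ => i; rewrite zE.
  by case: i => //=; exact: Sgam.
- by move=> x /SX; exact: condSet_gam_top.
- by move=> a b x y /SX Xx /SX Xy; exact: condSet_consistent.
- move=> I s x ps xs.
  have [z [[Xz zE] zu]] := condSet_stable sX ps (fun i => SX _ _ (xs i)).
  exists z; split; last by move=> w [/SX Xw wE]; exact: zu.
  by split=> //; apply: (Sloc I s) => // i; rewrite zE.
Qed.

(** The pieces also glue inside [S], and uniqueness of gluing in [X] identifies the result with
    [z]. *)
Lemma condSubset_glue (X : condData A) (S : A ->
  set (carrier X)) (I : Type) (s : I -> A) z :
  is_condSet X -> is_condSubset S -> partition_of \top s -> X \top z ->
  (forall i, S (s i) (gam (s i) z)) -> S \top z.
Proof.
move=> sX [SX sS] ps Xz Sz.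
have [w [[Sw wE] _]] := condSet_stable sS ps Sz.
have [z' [_ z'u]] := condSet_stable sX ps (fun i => SX _ _ (Sz i)).
by rewrite -(z'u z) // (z'u w) //; split=> //; exact: SX.
Qed.

Section OrderedSubfield.
Context (X : condData A) (add mul : condOp X) (zero one : carrier X) (le : condRel X).
Context (S : A -> set (carrier X)).
Context (fX : is_condOrderedField add mul zero one le) (sS : is_condSubset S).
Context (S0 : S \top zero) (S1 : S \top one).
Context (Sadd : forall a x y, S a x -> S a y -> S a (add a x y)).
Context (Smul : forall a x y, S a x -> S a y -> S a (mul a x y)).
Context (Sopp : forall x, S \top x -> exists2 y, S \top y & add \top y x = zero).
Context (Sinv : forall x, S \top x -> (forall a, \bot < a -> gam a x <> gam a zero) ->
  exists2 y, S \top y & mul \top x y = one /\ mul \top y x = one).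

Let rX := proj1 (condOrderedField_field fX).
Let sX := condRing_set rX.
Let SX a := @proj1 _ _ sS a.
Let leS : condRel (condRestr S) := fun a => le a `&` (S a `*` S a).

Lemma subfield_op (op : condOp X) : is_condOp op ->
  (forall a x y, S a x -> S a y -> S a (op a x y)) -> @is_condOp d A (condRestr S) op.
Proof.
move=> [_ opg] Sop; split=> a x [Sx Sy]; first exact: Sop.
by apply: opg; split; exact: SX.
Qed.

Lemma subfield_lt a x y : S a x -> S a y -> condLt le a x y -> condLt leS a x y.
Proof.
move=> Sx Sy [xy ne]; split=> // b w ba [z Sz zE] [z' Sz' z'E].
by apply: (ne b w) => //; [exists z|exists z'] => //; exact: SX.
Qed.

(** At [\top] an element is its own only extension, so the extensions that [X] provides are [x] and
    [y] themselves and lie in [S]. *)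
Lemma subfield_lt_top x y : condLt leS \top x y -> condLt le \top x y.
Proof.
move=> [[xy [/= Sx Sy]] ne]; split=> // b w ba [z Xz [zx zw]] [z' Xz' [z'y z'w]].
apply: (ne b w) => //.
  by exists z; rewrite // -(condSet_gam_top sX Xz) zx.
by exists z'; rewrite // -(condSet_gam_top sX Xz') z'y.
Qed.

Lemma subfield_order : is_condTotalOrder leS.
Proof.
have [[leR lerefl leanti letrans] letot] := condOrderedField_order fX.
split.
  split.
  - have sS2 := condProd_set (proj2 sS) (proj2 sS).
    apply: (@condSubset_local (condProd (condRestr S) (condRestr S)) _ (zero,
      zero)) => //.
    + by move=> a z [].
    + by split=> //; exact: lerefl (SX S0).
    + move=> a [x y] [xy [/= Sx Sy]]; split.
        exact: (condSet_gam_fun (proj2 leR) a xy).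
      by split; exact: (condSet_gam_fun (proj2 sS)).
    + move=> I s [x y] ps [/= Sx Sy] H; split=> //.
      apply: (condSubset_glue (condProd_set sX sX) leR ps).
        by split; exact: SX.
      by move=> i; have [] := H i.
  - by move=> x Sx; split=> //; exact: lerefl (SX Sx).
  - by move=> x y [xy _] [yx _]; exact: leanti.
  - move=> x y z [xy [Sx Sy]] [yz [_ Sz]]; split=> //.
    exact: letrans yz.
move=> x y Sx Sy; have [a [b [c [p xy yx e]]]] := letot x y (SX Sx) (SX Sy).
have Sg r z : S \top z -> S r (gam r z) by exact: (condSet_gam_fun (proj2 sS)).
by exists a, b, c; split=> //; apply: subfield_lt => //; exact: Sg.
Qed.

(** Identities, order axioms and the trichotomy are inherited; only closure under the operations,
    opposites and inverses has content. *)
Lemma condOrderedSubfield_closed : is_condOrderedSubfield add mul zero one le S.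
Proof.
have [_ fI] := condOrderedField_field fX; split=> //; split.
- split; last exact: Sinv.
  split=> //; first exact: (proj2 sS).
  + exact: subfield_op (condRing_add rX) Sadd.
  + exact: subfield_op (condRing_mul rX) Smul.
  + by move=> x y z /SX ? /SX ? /SX ?; exact: (condRing_addA rX).
  + by move=> x y /SX ? /SX ?; exact: (condRing_addC rX).
  + by move=> x /SX ?; exact: (condRing_add0 rX).
  + by move=> x y z /SX ? /SX ? /SX ?; exact: (condRing_mulA rX).
  + by move=> x /SX ?; exact: (condRing_mul1l rX).
  + by move=> x /SX ?; exact: (condRing_mul1r rX).
  + by move=> x y z /SX ? /SX ? /SX ?; exact: (condRing_mulDl rX).
  + by move=> x y z /SX ? /SX ? /SX ?; exact: (condRing_mulDr rX).
- exact: subfield_order.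
- move=> x y z Sx Sy Sz /subfield_lt_top xy; apply: subfield_lt; [exact: Sadd..|].
  by apply: (condOrderedField_add fX) => //; exact: SX.
- move=> x y Sx Sy /subfield_lt_top x0 /subfield_lt_top y0.
  apply: subfield_lt => //; first exact: Smul.
  by apply: (condOrderedField_mul fX) => //; exact: SX.
Qed.

End OrderedSubfield.

(** * Generated conditional sets *)

(** The truth value of [f x = w], where [s] is the name of [x]; [pmap2] is the same for a binary
    function. *)
Definition pmap (E F : Type) (f : E -> F) (s : E -> A) (w : F) : A :=
  sup [set s z | z in [set z | f z = w]].

Definition pmap2 (E F G : Type) (f : E -> F -> G) (s : E -> A) (t : F ->
  A) (u : G) : A :=
  sup [set s zw.1 `&` t zw.2 | zw in [set zw : E * F | f zw.1 zw.2 = u]].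

Section Pushforward.
Context (E F G : Type).
Implicit Types (s : E -> A) (t : F -> A).

Lemma le_pmap (f : E -> F) s c z : c <= s z -> c <= pmap f s (f z).
Proof. by move=> cs; apply: (le_trans cs); apply: le_sup; exists z. Qed.

Lemma pmap_dense (f : E -> F) s c w :
  c <= pmap f s w -> dense c (fun b => exists2 z, f z = w & b <= s z).
Proof.
move=> /le_sup_dense; apply: dense_imp => b b0 bc [_ [z fz <-] bz].
by exists z.
Qed.

Lemma part_pmap a (f : E -> F) s : partition_of a s -> partition_of a (pmap f s).
Proof.
move=> part; apply/partitionP; split=> [w|b b0 ba|c v w c0 cv cw].
- by apply: sup_le => _ [z _ <-]; exact: part_le.
- have [z [c [c0 cb cz]]] := part_decide part b0 ba.
  by exists c; split=> //; exists (f z); exact: le_pmap.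
- have [b [b0 bc [z <- bz]]] := pmap_dense cv c0 (lexx _).
  have [e [e0 eb [y <- ey]]] := pmap_dense cw b0 bc.
  by congr f; apply: (part_uniq part e0) => //; exact: le_trans bz.
Qed.

Lemma le_pmap2 (f : E -> F -> G) s t c z w :
  c <= s z -> c <= t w -> c <= pmap2 f s t (f z w).
Proof.
move=> cs ct; apply: (@le_trans _ _ (s z `&` t w)); first by rewrite lexI cs.
by apply: le_sup; exists (z, w).
Qed.

Lemma pmap2_dense (f : E -> F -> G) s t c u : c <= pmap2 f s t u ->
  dense c (fun b => exists z w, [/\ f z w = u, b <= s z & b <= t w]).
Proof.
move=> /le_sup_dense; apply: dense_imp => b b0 bc [_ [[z w] /= fz <-]].
by rewrite lexI => /andP[bz bw]; exists z, w.
Qed.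

Lemma part_pmap2 a (f : E -> F -> G) s t :
  partition_of a s -> partition_of a t -> partition_of a (pmap2 f s t).
Proof.
move=> ps pt; apply/partitionP; split=> [u|b b0 ba|c v w c0 cv cw].
- by apply: sup_le => _ [z _ <-]; apply: le_trans (part_le ps z.1); exact: leIl.
- have [z [c [c0 cb cz]]] := part_decide ps b0 ba.
  have [w [e [e0 ec ew]]] := part_decide pt c0 (le_trans cb ba).
  exists e; split=> //; first exact: le_trans cb.
  by exists (f z w); apply: le_pmap2 => //; exact: le_trans cz.
- have [b [b0 bc [z [y [<- bz bY]]]]] := pmap2_dense cv c0 (lexx _).
  have [e [e0 eb [z' [y' [<- ez ey]]]]] := pmap2_dense cw b0 bc.
  rewrite (part_uniq ps e0 (le_trans eb bz) ez).
  by rewrite (part_uniq pt e0 (le_trans eb bY) ey).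
Qed.

End Pushforward.

Section FormalSums.
Context (E F G : Type).
Implicit Types (s : formalSum A E) (phi : E -> A) (X Y : set (formalSum A E)).

Lemma le_fs_at s (i : fs_index s) : fs_cond i <= fs_at s (fs_val i).
Proof. by apply: (le_sup); exists i. Qed.

Lemma fs_at_dense s c z : c <= fs_at s z ->
  dense c (fun b => exists2 i, @fs_val _ _ _ s i = z & b <= fs_cond i).
Proof.
move=> /le_sup_dense; apply: dense_imp => b b0 bc [_ [i iz <-] bi].
by exists i.
Qed.

(** By conversion, [fs_at s] is the pushforward of the conditions of [s] along its values. *)
Lemma part_fs_at a s : partition_of a (@fs_cond _ _ _ s) -> partition_of a (fs_at s).
Proof. exact: part_pmap. Qed.

Lemma fs_at_id phi : fs_at (FormalSum phi id) = phi.
Proof.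
apply/funext => z; apply/le_anti/andP; split;
  last exact: (@le_fs_at (FormalSum phi id) z).
by apply: sup_le => _ [i /= -> <-].
Qed.

(** Each class has exactly one representative indexed by [E] itself with identity values. Thus the
    elements over [a] are the same as the partitions of [a] indexed by [E], with [gen_at] as the
    inverse of [gen_mk]. *)
Definition gen_mk a phi : set (formalSum A E) := gen_class a (FormalSum phi id).

Lemma gen_classE a s : gen_class a s = gen_mk a (fs_at s).
Proof.
by apply/seteqP; split=> t [pt st]; split=> // z; have := st z; rewrite fs_at_id.
Qed.

(* The largest condition on which [X] takes the value [z]. *)
Definition gen_at (X : set (formalSum A E)) (z : E) : A :=
  sup [set fs_at s z | s in X].

Lemma gen_at_mem a X s : gen_elts a X -> X s -> fs_at s = gen_at X.
Proof.
move=> [t pt <-] [ps ts]; apply/funext => z; apply/le_anti/andP; split.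
  by apply: le_sup; exists s.
by apply: sup_le => _ [r [_ tr] <-]; rewrite -ts tr.
Qed.

Lemma gen_elts_neq0 a X : gen_elts a X -> X !=set0.
Proof. by move=> [t pt <-]; exists t; split. Qed.

Lemma part_gen_at a X : gen_elts a X -> partition_of a (gen_at X).
Proof.
move=> eX; have [s Xs] := gen_elts_neq0 eX.
rewrite -(gen_at_mem eX Xs); apply: part_fs_at.
by case: eX Xs => t _ <- [].
Qed.

Lemma gen_mkK a X : gen_elts a X -> gen_mk a (gen_at X) = X.
Proof.
move=> eX; have [t pt tX] := eX.
by rewrite -[in RHS]tX gen_classE (gen_at_mem eX) // -tX.
Qed.

Lemma gen_mk_elts a phi : partition_of a phi -> gen_elts a (gen_mk a phi).
Proof. by move=> p; exists (FormalSum phi id). Qed.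

Lemma gen_mk_at a phi : partition_of a phi -> gen_at (gen_mk a phi) = phi.
Proof.
move=> p; rewrite -[RHS]fs_at_id; apply/esym/gen_at_mem; first exact: gen_mk_elts p.
by split.
Qed.

Lemma gen_ext a X Y : gen_elts a X -> gen_elts a Y ->
  (forall c z w, \bot < c -> c <= gen_at X z -> c <= gen_at Y w -> z = w) -> X = Y.
Proof.
move=> eX eY XY; rewrite -(gen_mkK eX) -(gen_mkK eY).
by rewrite (part_ext (part_gen_at eX) (part_gen_at eY)).
Qed.

(** Evaluates the unions over representatives by which restriction and the operations are defined:
    the family is constant and its index set is inhabited. *)
Lemma gen_bigcup b X (T : Type) (g : formalSum A E -> set T) Z : gen_elts b X ->
  (forall s, X s -> g s = Z) -> \bigcup_(s in X) g s = Z.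
Proof.
move=> eX gZ; under eq_bigcupr do rewrite gZ //.
by rewrite bigcup_const //; exact: gen_elts_neq0 eX.
Qed.

Lemma gamE b a (X : carrier (condGen A E)) : gen_elts b X ->
  gam a X = gen_mk a (fun z => a `&` gen_at X z).
Proof.
move=> eX; apply: (gen_bigcup eX) => s Xs; rewrite gen_classE; congr gen_mk.
rewrite -(gen_at_mem eX Xs); apply/funext => z; apply/le_anti/andP; split.
  by apply: sup_le => // _ [i iz <-] /=; rewrite leI2 // -iz; exact: le_fs_at.
apply: le_dense => c c0; rewrite lexI => /andP[ca cz].
have [e [e0 ec [i iz ei]]] := fs_at_dense cz c0 (lexx _).
exists e; split=> //; rewrite -iz.
apply: (le_trans _ (@le_fs_at (fs_restr a s) i)).
by rewrite /= lexI ei (le_trans ec ca).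
Qed.

End FormalSums.

Section GeneratedTheory.
Context (E F G : Type).
Implicit Types (X : carrier (condGen A E)) (Y : carrier (condGen A F)).

Lemma gen_mapE b a (f : E -> F) X : gen_elts b X ->
  gen_map f a X = gen_mk a (pmap f (gen_at X)).
Proof.
move=> eX; apply: (gen_bigcup eX) => s Xs; rewrite gen_classE; congr gen_mk.
rewrite -(gen_at_mem eX Xs); apply/funext => w; apply/le_anti/andP; split.
  by apply: sup_le => // _ [i /= <- <-] /=; apply: le_pmap; exact: le_fs_at.
apply: le_dense => c c0 cw.
have [b' [b0 bc [z <- bz]]] := pmap_dense cw c0 (lexx _).
have [e [e0 eb [i iz ei]]] := fs_at_dense bz b0 (lexx _).
exists e; split=> //; first exact: le_trans bc.
by rewrite -iz; exact: le_trans ei (@le_fs_at _ (fs_map f s) i).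
Qed.

Lemma gen_map2E b a (f : E -> F -> G) X Y : gen_elts b X -> gen_elts b Y ->
  gen_map2 f a X Y = gen_mk a (pmap2 f (gen_at X) (gen_at Y)).
Proof.
move=> eX eY; apply: (gen_bigcup eX) => s Xs; apply: (gen_bigcup eY) => t Yt.
rewrite gen_classE; congr gen_mk.
rewrite -(gen_at_mem eX Xs) -(gen_at_mem eY Yt).
apply/funext => w; apply/le_anti/andP; split.
  apply: sup_le => // _ [[i j] /= <- <-] /=.
  by apply: le_pmap2; [apply: le_trans (le_fs_at i); exact: leIl
                      |apply: le_trans (le_fs_at j); exact: leIr].
apply: le_dense => c c0 cw.
have [b' [b0 bc [z [w' [<- bz bw]]]]] := pmap2_dense cw c0 (lexx _).
have [e [e0 eb [i iz ei]]] := fs_at_dense bz b0 (lexx _).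
have [e' [e'0 e'b [j jz ej]]] := fs_at_dense (le_trans eb bw) e0 (lexx _).
exists e'; split=> //; first exact: le_trans e'b (le_trans eb bc).
rewrite -iz -jz; apply: (le_trans _ (@le_fs_at _ (fs_map2 f s t) (i, j))).
by rewrite /= lexI ej (le_trans e'b ei).
Qed.

Lemma gen_map_elts a (f : E -> F) X : gen_elts a X -> gen_elts a (gen_map f a X).
Proof.
by move=> eX; rewrite (gen_mapE a f eX); apply/gen_mk_elts/part_pmap/part_gen_at.
Qed.

Lemma gen_map2_elts a (f : E -> F -> G) X Y : gen_elts a X -> gen_elts a Y ->
  gen_elts a (gen_map2 f a X Y).
Proof.
move=> eX eY; rewrite (gen_map2E a f eX eY).
by apply: gen_mk_elts; apply: part_pmap2; exact: part_gen_at.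
Qed.

Lemma gen_map_at a (f : E -> F) X c z : gen_elts a X ->
  c <= gen_at X z -> c <= gen_at (gen_map f a X) (f z).
Proof.
move=> eX cz; rewrite (gen_mapE a f eX) gen_mk_at; first exact: le_pmap.
exact/part_pmap/part_gen_at.
Qed.

Lemma gen_map2_at a (f : E -> F -> G) X Y c z w : gen_elts a X -> gen_elts a Y ->
  c <= gen_at X z -> c <= gen_at Y w -> c <= gen_at (gen_map2 f a X Y) (f z w).
Proof.
move=> eX eY cz cw; rewrite (gen_map2E a f eX eY) gen_mk_at; first exact: le_pmap2.
by apply: part_pmap2; exact: part_gen_at.
Qed.

Lemma gam_elts b a X : gen_elts b X -> a <= b -> gen_elts a (gam a X).
Proof.
move=> eX ab; rewrite (gamE a eX); apply: gen_mk_elts.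
by apply: (part_restr (part_gen_at eX) ab).
Qed.

Lemma gam_at b a X z : gen_elts b X -> a <= b ->
  gen_at (gam a X) z = a `&` gen_at X z.
Proof.
move=> eX ab; rewrite (gamE a eX) gen_mk_at //.
by apply: (part_restr (part_gen_at eX) ab).
Qed.

Lemma gam_gam e b a X : gen_elts e X -> b <= e -> a <= b ->
  gam a (gam b X) = gam a X.
Proof.
move=> eX be ab; rewrite (gamE a (gam_elts eX be)) (gamE a eX); congr gen_mk.
by apply/funext => z; rewrite (gam_at z eX be) meetA [a `&` b]meet_l.
Qed.

Lemma gam_id a X : gen_elts a X -> gam a X = X.
Proof.
move=> eX; rewrite (gamE a eX) -[RHS](gen_mkK eX); congr gen_mk.
by apply/funext => z; rewrite meet_r //; exact: part_le (part_gen_at eX) z.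
Qed.

Lemma part_unit a : partition_of a (fun _ : unit => a).
Proof.
apply/partitionP; split=> [//|b b0 ba|c [] []//].
by exists b; split=> //; exists tt.
Qed.

Lemma gen_const_elts a (z : E) : gen_elts a (gen_const a z).
Proof.
by exists (FormalSum (fun _ : unit => a) (fun=> z)) => //; exact: part_unit.
Qed.

Lemma gen_const_at a c (z : E) : c <= a -> c <= gen_at (gen_const a z) z.
Proof.
move=> ca; pose s := FormalSum (fun _ : unit => a) (fun=> z).
rewrite -(gen_at_mem (gen_const_elts a z) (s := s)).
  exact: le_trans ca (@le_fs_at _ s tt).
by split=> //; exact: part_unit.
Qed.

(** The definition asks for one suitable pair of representatives. Comparing values decided below a
    common condition removes the choice, because [gen_at] is computed by every representative. *)
Lemma gen_relP (r : E -> E -> Prop) a (X X' : carrier (condGen A E)) :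
  gen_rel r a (X, X') <-> [/\ gen_elts a X, gen_elts a X' &
    forall c z w, \bot < c -> c <= gen_at X z -> c <= gen_at X' w -> r z w].
Proof.
split=> [[/= eX eX' [s Xs [t X't st]]]|[eX eX' rXX']].
  split=> // c z w c0; rewrite -(gen_at_mem eX Xs) -(gen_at_mem eX' X't) => cz cw.
  have [e [e0 ec [i <- ei]]] := fs_at_dense cz c0 (lexx _).
  have [e' [e'0 e'e [j <- ej]]] := fs_at_dense (le_trans ec cw) e0 (lexx _).
  apply: st; rewrite -lt0x; apply: lt_le_trans e'0 _.
  by rewrite lexI ej (le_trans e'e ei).
split=> //; have [s Xs] := gen_elts_neq0 eX; have [t X't] := gen_elts_neq0 eX'.
exists s => //; exists t => // i j; rewrite -lt0x => m0.
apply: (rXX' _ _ _ m0).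
  by rewrite -(gen_at_mem eX Xs); apply: le_trans (le_fs_at i); exact: leIl.
by rewrite -(gen_at_mem eX' X't); apply: le_trans (le_fs_at j); exact: leIr.
Qed.

End GeneratedTheory.

Lemma gam_map (E F : Type) a b (f : E ->
  F) (X : carrier (condGen A E)) : gen_elts a X -> b <= a ->
  gam b (gen_map f a X) = gen_map f b (gam b X) :> carrier (condGen A F).
Proof.
move=> eX ba; have efX := gen_map_elts f eX; have ebX := gam_elts eX ba.
apply: (gen_ext (a := b)); [exact: gam_elts efX ba|exact: gen_map_elts|move=> c z w c0].
rewrite (gam_at _ efX ba) lexI => /andP[cb cz] cw.
have [y [e [e0 ec ey]]] := part_decide (part_gen_at eX) c0 (le_trans cb ba).
rewrite (part_uniq (part_gen_at efX) e0 (le_trans ec cz) (gen_map_at f eX ey)).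
apply: (part_uniq (part_gen_at (gen_map_elts f ebX)) e0 _ (le_trans ec cw)).
by apply: gen_map_at => //; rewrite (gam_at _ eX ba) lexI (le_trans ec cb).
Qed.

Lemma gam_map2 (E F G : Type) a b (f : E -> F -> G)
    (X : carrier (condGen A E)) (Y : carrier (condGen A F)) :
  gen_elts a X -> gen_elts a Y -> b <= a ->
  gam b (gen_map2 f a X Y) = gen_map2 f b (gam b X) (gam b Y) :> carrier (condGen A G).
Proof.
move=> eX eY ba; have efX := gen_map2_elts f eX eY.
have ebX := gam_elts eX ba; have ebY := gam_elts eY ba.
apply: (gen_ext (a := b)); [exact: gam_elts efX ba|exact: gen_map2_elts|move=> c z w
  c0].
rewrite (gam_at _ efX ba) lexI => /andP[cb cz] cw.
have [y [e [e0 ec ey]]] := part_decide (part_gen_at eX) c0 (le_trans cb ba).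
have [x [g [g0 ge gx]]] := part_decide (part_gen_at eY) e0 (le_trans ec (le_trans cb
  ba)).
have gy := le_trans ge ey; have gc := le_trans ge ec.
rewrite (part_uniq (part_gen_at efX) g0 (le_trans gc cz) (gen_map2_at f eX eY gy gx)).
apply: (part_uniq (part_gen_at (gen_map2_elts f ebX ebY)) g0 _ (le_trans gc cw)).
by apply: gen_map2_at => //; rewrite (gam_at _ _ ba) // lexI (le_trans gc cb).
Qed.

(** [restricts] goes through an element over [\top]; the default [z0] fills the complement of [a] in
    order to produce one. *)
Lemma gen_restricts (E : Type) (z0 : E) a b (X Y : carrier (condGen A E)) : b <= a ->
  restricts a b X Y <-> gen_elts a X /\ Y = gam b X.
Proof.
move=> ba; split=> [[Z eZ [<- <-]]|[eX ->]].
  by rewrite (gam_gam eZ (lex1 a) ba); split=> //; exact: gam_elts (lex1 a).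
pose f (i : bool) := if i then gen_at X else gen_at (gen_const (~` a) z0).
have pf i : partition_of (if i then a else ~` a) (f i).
  by case: i; [exact: part_gen_at|apply/part_gen_at/gen_const_elts].
have pc := part_compl a; have pg := part_glue pc pf.
have eg := gen_mk_elts pg; exists (gen_mk \top (glue f)) => //.
have gX : gam a (gen_mk \top (glue f) : carrier (condGen A E)) = X.
  rewrite (gamE a eg) -[RHS](gen_mkK eX); congr gen_mk; apply/funext => z.
  by rewrite gen_mk_at // (glue_restr true z pc pf).
by split=> //; rewrite -(gam_gam eg (lex1 a) ba) gX.
Qed.

(** * Order and arithmetic of the conditional rationals *)

(* Keep from the supremum of each [P k] what no earlier [P j] covers. *)
Lemma dense_choice a (P : nat -> A -> Prop) :
  (forall k b c, c <= b -> P k b -> P k c) -> dense a (fun b => exists k, P k b) ->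
  exists s : nat -> A, partition_of a s /\ forall k, dense (s k) (P k).
Proof.
move=> Pdown aP; pose p k := sup [set b | b <= a /\ P k b].
have pa k : p k <= a by apply: sup_le => b [].
have pP k : dense (p k) (P k).
  apply: dense_imp (le_sup_dense (lexx _)) => b b0 _ [e [ea Pe] be].
  exact: Pdown Pe.
pose s k := p k `&` ~` sup [set p j | j in [set j | (j < k)%N]].
have sp k : s k <= p k by exact: leIl.
exists s; split; last by move=> k; apply: dense_sub (pP k).
apply/partitionP; split=> [k|b b0 ba|c i j c0].
- exact: le_trans (pa k).
- have : exists k, `[< exists c, [/\ \bot < c, c <= b & c <= p k] >].
    have [c [c0 cb [k Pk]]] := aP b b0 ba.
    exists k; apply/asboolP; exists c; split=> //; apply: le_sup; split=> //.
    exact: le_trans ba.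
  move=> ex; case: (ex_minnP ex) => k /asboolP[c [c0 cb ck]] kmin.
  exists c; split=> //; exists k; rewrite lexI ck lexC.
  apply: sup_le => _ [j jk <-]; rewrite -disj_leC; apply/negPn/negP => jc.
  suff : (k <= j)%N by rewrite leqNgt jk.
  apply: kmin; apply/asboolP; exists (p j `&` c); split; first by rewrite lt0x.
    exact: le_trans (leIr _ _) cb.
  exact: leIl.
- wlog ij : i j / (i < j)%N.
    move=> H ci cj; have [| |//] := ltngtP i j; last by move=> ji; apply/esym/H.
    by move=> ij; exact: H.
  rewrite !lexI => /andP[ci _] /andP[_]; rewrite lexC => jc.
  have : c <= c `&` ~` c.
    rewrite lexI lexx; apply: le_trans jc; apply: (le_trans ci).
    by apply: le_sup; exists i.
  by rewrite meetxC lex0 (gt_eqF c0).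
Qed.

Lemma gen_surj (E : Type) (z0 : E) a (X : carrier (condGen A E)) : gen_elts a X ->
  exists2 Z, condGen A E \top Z & gam a Z = X.
Proof.
move=> eX; have /(gen_restricts z0 _ _ (lexx a))[Z eZ [ZX _]] : gen_elts a X /\ X =
  gam a X.
  by rewrite (gam_id eX).
by exists Z.
Qed.

Lemma gam_const (E : Type) a b (z : E) : b <= a ->
  gam b (gen_const a z : carrier (condGen A E)) = gen_const b z.
Proof.
move=> ba; have ea := gen_const_elts a z.
apply: (gen_ext (gam_elts ea ba) (gen_const_elts b z)) => c w w' c0.
rewrite (gam_at _ ea ba) lexI => /andP[cb cw] cw'.
rewrite (part_uniq (part_gen_at ea) c0 cw (gen_const_at z (le_trans cb ba))).
by rewrite (part_uniq (part_gen_at (gen_const_elts b z)) c0 cw' (gen_const_at z cb)).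
Qed.

Lemma gam_decided (E : Type) a c (X : carrier (condGen A E)) z : gen_elts a X ->
  c <= gen_at X z -> gam c X = gen_const c z.
Proof.
move=> eX cz; have ca := le_trans cz (part_le (part_gen_at eX) z).
apply: (gen_ext (gam_elts eX ca) (gen_const_elts c z)) => e w w' e0.
rewrite (gam_at _ eX ca) lexI => /andP[ec ew] ew'.
rewrite (part_uniq (part_gen_at eX) e0 ew (le_trans ec cz)).
by rewrite (part_uniq (part_gen_at (gen_const_elts c z)) e0 ew' (gen_const_at z ec)).
Qed.

(** If the values coincided on a nonzero [c], both elements would restrict to the same constant
    there, which strictness forbids. Conversely, equal restrictions to a nonzero condition would
    yield a decided value [z] with [z < z]. *)
Lemma qltP a (X Y : carrier (condRat A)) : qlt a X Y <->
  [/\ gen_elts a X, gen_elts a Y &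
    forall c z w, \bot < c -> c <= gen_at X z -> c <= gen_at Y w -> (z < w)%R].
Proof.
split=> [[/gen_relP[eX eY XY] nXY]|[eX eY XY]].
  split=> // c z w c0 cz cw; rewrite lt_neqAle (XY c) // andbT; apply/eqP => zw.
  have ca := le_trans cz (part_le (part_gen_at eX) z).
  have := nXY c (gen_const c z) ca.
  rewrite (gen_restricts (0%R : rat) _ _ ca) (gen_restricts (0%R : rat) _ _ ca).
  rewrite (gam_decided eX cz) (gam_decided eY cw) zw => cE.
  by move: c0; rewrite cE // ltxx.
split; first by apply/gen_relP; split=> // c z w c0 cz cw; apply/ltW/(XY c).
move=> b W ba /(gen_restricts (0%R : rat) _ _ ba)[_ ->] /(gen_restricts (0%R : rat) _
  _ ba)[_ XYb].
apply/eqP/negPn/negP; rewrite -lt0x => b0.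
have [z [c [c0 cb cz]]] := part_decide (part_gen_at eX) b0 ba.
have : c <= gen_at (gam b X) z by rewrite (gam_at _ eX ba) lexI cb.
rewrite XYb (gam_at _ eY ba) lexI => /andP[_ /(XY c z z c0 cz)].
by rewrite ltxx.
Qed.

Lemma qposP a (X : carrier (condRat A)) : qpos a X <->
  gen_elts a X /\ forall c z, \bot < c -> c <= gen_at X z -> (0 < z)%R.
Proof.
have e0 := gen_const_elts a (0%R : rat).
split=> [[eX /qltP[_ _ X0]]|[eX X0]].
  split=> // c z c0 cz; apply: (X0 c _ _ c0 _ cz); apply: gen_const_at.
  exact: le_trans cz (part_le (part_gen_at eX) z).
split=> //; apply/qltP; split=> // c w z c0 cw cz.
rewrite (part_uniq (part_gen_at e0) c0 cw (gen_const_at _ _)); first exact: (X0 c).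
exact: le_trans cz (part_le (part_gen_at eX) z).
Qed.

Lemma qsub_elts a (X Y : carrier (condRat A)) :
  gen_elts a X -> gen_elts a Y -> gen_elts a (qsub a X Y).
Proof. by move=> eX eY; apply: gen_map2_elts => //; exact: gen_map_elts. Qed.

Lemma qsub_at a (X Y : carrier (condRat A)) c z w : gen_elts a X -> gen_elts a Y ->
  c <= gen_at X z -> c <= gen_at Y w -> c <= gen_at (qsub a X Y) (z - w)%R.
Proof.
move=> eX eY cz cw; apply: gen_map2_at => //; first exact: gen_map_elts.
exact: gen_map_at.
Qed.

Lemma qabs_elts a (X : carrier (condRat A)) : gen_elts a X -> gen_elts a (qabs a X).
Proof. by move=> eX; apply: gen_map2_elts => //; exact: gen_map_elts. Qed.

Lemma qabs_at a (X : carrier (condRat A)) c z : gen_elts a X ->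
  c <= gen_at X z -> c <= gen_at (qabs a X) `|z|%R.
Proof.
move=> eX cz; rewrite -maxrN; apply: gen_map2_at => //; first exact: gen_map_elts.
exact: gen_map_at.
Qed.

Lemma qdist_ltP a (X Y Z : carrier (condRat A)) :
  gen_elts a X -> gen_elts a Y -> gen_elts a Z ->
  qlt a (qabs a (qsub a X Y)) Z <->
  forall c z w e, \bot < c -> c <= gen_at X z -> c <= gen_at Y w ->
    c <= gen_at Z e -> (`|z - w| < e)%R.
Proof.
move=> eX eY eZ; have eXY := qsub_elts eX eY; have eD := qabs_elts eXY.
split=> [/qltP[_ _ D] c z w e c0 cz cw ce|D].
  by apply: (D c) => //; apply: qabs_at => //; exact: qsub_at.
apply/qltP; split=> // c u e c0 cu ce.
have [z [b [b0 bc bz]]] :=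
  part_decide (part_gen_at eX) c0 (le_trans ce (part_le (part_gen_at eZ) e)).
have [w [f [f0 fb fw]]] :=
  part_decide (part_gen_at eY) b0 (le_trans bz (part_le (part_gen_at eX) z)).
have fc := le_trans fb bc; have fz := le_trans fb bz.
rewrite (part_uniq (part_gen_at eD) f0 (le_trans fc cu)
  (qabs_at eXY (qsub_at eX eY fz fw))).
by apply: (D f) => //; exact: le_trans fc ce.
Qed.

Lemma qopp_lt_subP a (X Y Z : carrier (condRat A)) :
  gen_elts a X -> gen_elts a Y -> gen_elts a Z ->
  qlt a (qopp a Z) (qsub a X Y) <->
  forall c z w e, \bot < c -> c <= gen_at X z -> c <= gen_at Y w ->
    c <= gen_at Z e -> (- e < z - w)%R.
Proof.
move=> eX eY eZ; have eXY := qsub_elts eX eY;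
  have eN : gen_elts a (qopp a Z) by exact: gen_map_elts.
split=> [/qltP[_ _ D] c z w e c0 cz cw ce|D].
  by apply: (D c) => //; [exact: gen_map_at|exact: qsub_at].
apply/qltP; split=> // c v u c0 cv cu;
  have ca := le_trans cv (part_le (part_gen_at eN) v).
have [z [b [b0 bc bz]]] := part_decide (part_gen_at eX) c0 ca.
have [w [f [f0 fb fw]]] := part_decide (part_gen_at eY) b0 (le_trans bc ca).
have [e [g [g0 gf ge]]] := part_decide (part_gen_at eZ) f0 (le_trans fb (le_trans bc
  ca)).
have gz := le_trans gf (le_trans fb bz); have gw := le_trans gf fw.
have gc := le_trans gf (le_trans fb bc).
rewrite (part_uniq (part_gen_at eN) g0 (le_trans gc cv) (gen_map_at (fun x : rat =>
  (- x)%R : rat) eZ ge)).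
rewrite (part_uniq (part_gen_at eXY) g0 (le_trans gc cu) (qsub_at eX eY gz gw)).
exact: (D g).
Qed.

(** * Conditional sequences as names *)

Implicit Types (e z w : rat) (k m n : nat).

Local Notation seqfun a q := (@is_condfun_on d A a (condNat A) (condRat A) q).

Lemma seqfunP a q : seqfun a q <->
  (forall b (n : carrier (condNat A)), b <= a -> gen_elts b n -> gen_elts b (q b n)) /\
  (forall b (n : carrier (condNat A)), b <= a -> gen_elts a n ->
    q b (gam b n) = gam b (q a n)).
Proof.
split=> -[qf qr]; split.
- by move=> b n ba bn; exact: qf bn.
- move=> b n ba an; have /(qr _ _ _ ba an) : restricts a b (n : carrier (condNat A))
    (gam b n).
    exact/(gen_restricts 0%N _ _ ba).
  by move=> /(gen_restricts (0%R : rat) _ _ ba)[].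
- by move=> b ba n bn; exact: qf.
- move=> b n m ba an /(gen_restricts 0%N _ _ ba)[_ ->].
  by apply/(gen_restricts (0%R : rat) _ _ ba); split; [exact: qf|exact: qr].
Qed.

Definition seq_at (q : qseq A) a (k : nat) (z : rat) : A :=
  gen_at (q a (gen_const a k)) z.

Section SequenceNames.
Context (a : A) (q : qseq A) (fq : seqfun a q).

Lemma seqfun_elts b (n : carrier (condNat A)) : b <= a -> gen_elts b n ->
  gen_elts b (q b n).
Proof. by have /seqfunP[+ _] := fq; apply. Qed.

Lemma seqfun_gam b (n : carrier (condNat A)) : b <= a -> gen_elts a n ->
  q b (gam b n) = gam b (q a n).
Proof. by have /seqfunP[_] := fq; apply. Qed.

Lemma seqfun_restr b : b <= a -> seqfun b q.
Proof.
move=> ba; apply/seqfunP; split=> c n cb cn.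
  exact: seqfun_elts (le_trans cb ba) cn.
(* Compatibility of [q] with restriction is known only for indices over [a], so the index [n] over
   [b] is first extended to [\top] and brought down to [a]. *)
have [Z eZ <-] := gen_surj 0%N cn.
rewrite (gam_gam eZ (lex1 b) cb) -(gam_gam eZ (lex1 a) (le_trans cb ba)).
rewrite -(gam_gam eZ (lex1 a) ba); have eaZ := gam_elts eZ (lex1 a).
rewrite (seqfun_gam (le_trans cb ba) eaZ) (seqfun_gam ba eaZ).
by rewrite (gam_gam (seqfun_elts (lexx a) eaZ) ba cb).
Qed.

Lemma part_seq_at k : partition_of a (seq_at q a k).
Proof. by apply/part_gen_at/seqfun_elts => //; exact: gen_const_elts. Qed.

Lemma seq_at_restr b k z : b <= a -> seq_at q b k z = b `&` seq_at q a k z.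
Proof.
move=> ba; rewrite /seq_at -(gam_const k ba) seqfun_gam //.
  by rewrite (gam_at _ _ ba) //; apply: seqfun_elts => //; exact: gen_const_elts.
exact: gen_const_elts.
Qed.

(** On [c] the index [n] restricts to the constant [k], and [q] commutes with restriction. This is
    how the terms at standard indices determine a conditional sequence. *)
Lemma seq_at_decided (n : carrier (condNat A)) c k z : gen_elts a n ->
  c <= gen_at n k ->
  (c <= gen_at (q a n) z) = (c <= seq_at q a k z).
Proof.
move=> en ck; have ca := le_trans ck (part_le (part_gen_at en) k).
have := seq_at_restr k z ca; rewrite {1}/seq_at -(gam_decided en ck) seqfun_gam //.
rewrite (gam_at _ _ ca) => [E|]; last exact: seqfun_elts.
have {1}-> : (c <= gen_at (q a n) z) = (c <= c `&` gen_at (q a n) z).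
  by rewrite lexI lexx.
by rewrite E lexI lexx.
Qed.

End SequenceNames.

(* The conditional [n0] is mixed from standard indices, the conditional [eps]
   being standard on each piece. *)
Lemma mixing a (P : rat -> nat -> A -> Prop) :
  (forall e k b c, c <= b -> P e k b -> P e k c) ->
  (forall e k b, dense b (P e k) -> P e k b) ->
  (forall eps : carrier (condRat A), qpos a eps ->
     exists2 n0 : carrier (condNat A), condNat A a n0 &
     forall c e k, \bot < c -> c <= gen_at eps e -> c <= gen_at n0 k -> P e k c) <->
  (forall e, (0 < e)%R -> dense a (fun b => exists k, P e k b)).
Proof.
move=> Pdown Ploc; split=> [aP e e0 b b0 ba|aP eps /qposP[eeps eps0]].
  have ee := gen_const_elts a e.
  have [|n0 en0 n0P] := aP (gen_const a e).
    apply/qposP; split=> // c z c0 cz.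
    have ca := le_trans cz (part_le (part_gen_at ee) z).
    by rewrite (part_uniq (part_gen_at ee) c0 cz (gen_const_at e ca)).
  have [k [c [c0 cb ck]]] := part_decide (part_gen_at en0) b0 ba.
  exists c; split=> //; exists k; apply: n0P => //; apply: gen_const_at.
  exact: le_trans ba.
have [||s [ps sP]] := @dense_choice a (fun k b => exists2 e,
  b <= gen_at eps e & P e k b).
- by move=> k b c cb [e be Pe]; exists e; [exact: le_trans be|exact: Pdown Pe].
- move=> b b0 ba; have [e [c [c0 cb ce]]] := part_decide (part_gen_at eeps) b0 ba.
  have [c' [c'0 c'c [k Pk]]] := aP e (eps0 c e c0 ce) c c0 (le_trans cb ba).
  exists c'; split=> //; first exact: le_trans cb.
  by exists k, e => //; exact: le_trans ce.
exists (gen_mk a s : carrier (condNat A)); first exact: gen_mk_elts.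
rewrite (gen_mk_at ps) => c e k c0 ce ck; apply: Ploc.
apply: dense_imp (dense_sub ck (sP k)) => b b0 bc [e' be' Pe'].
by rewrite (part_uniq (part_gen_at eeps) b0 (le_trans bc ce) be').
Qed.

(** * Tail bounds on names and their conditional counterparts *)

Definition holds_from (v u : nat -> rat -> A) (R : rat -> rat -> Prop) (k : nat) c :=
  forall n b z w, (k <= n)%N -> \bot < b -> b <= c -> b <= v n z -> b <= u n w -> R z w.

Definition eventually a (v u : nat -> rat -> A) (R : rat -> rat -> Prop) :=
  dense a (fun b => exists k, holds_from v u R k b).

Definition cauchy_from (v : nat -> rat -> A) (e : rat) (k : nat) c :=
  forall m n b z w, (k <= m)%N -> (k <= n)%N -> \bot < b -> b <= c ->
    b <= v m z -> b <= v n w -> (`|w - z| < e)%R.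

Definition cauchy_on a (v : nat -> rat -> A) :=
  forall e, (0 < e)%R -> dense a (fun b => exists k, cauchy_from v e k b).

Definition close_on a (v u : nat -> rat -> A) :=
  forall e, (0 < e)%R -> eventually a v u (fun z w => `|z - w| < e)%R.

(** The names are swapped on purpose: [z] is a value of [u] and [w] one of [v], since the order
    bounds from below the larger sequence minus the smaller. *)
Definition le_on a (v u : nat -> rat -> A) :=
  forall e, (0 < e)%R -> eventually a u v (fun z w => - e < z - w)%R.

Lemma holds_from_sub v u R k b c : c <= b -> holds_from v u R k b ->
  holds_from v u R k c.
Proof. by move=> cb H n e z w kn e0 ec; apply: H => //; exact: le_trans cb. Qed.

Lemma holds_from_dense v u R k b :
  dense b (holds_from v u R k) -> holds_from v u R k b.
Proof.
move=> bH n c z w kn c0 cb cz cw; have [e [e0 ec He]] := bH c c0 cb.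
by apply: (He n e) => //; exact: le_trans ec _.
Qed.

Lemma cauchy_from_sub v e k b c : c <= b -> cauchy_from v e k b -> cauchy_from v e k c.
Proof. by move=> cb H m n f z w km kn f0 fc; apply: H => //; exact: le_trans cb. Qed.

Lemma cauchy_from_dense v e k b : dense b (cauchy_from v e k) -> cauchy_from v e k b.
Proof.
move=> bH m n c z w km kn c0 cb cz cw; have [f [f0 fc Hf]] := bH c c0 cb.
by apply: (Hf m n f) => //; exact: le_trans fc _.
Qed.

Lemma nle_max a (n0 : carrier (condNat A)) n : gen_elts a n0 ->
  nle a (n0, gen_map (maxn n) a n0).
Proof.
move=> en0; have em := gen_map_elts (maxn n) en0; apply/gen_relP; split=> //.
move=> c k m c0 ck cm.
by rewrite (part_uniq (part_gen_at em) c0 cm (gen_map_at (maxn n) en0 ck)) leq_maxr.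
Qed.

Lemma gen_max_at a (n0 : carrier (condNat A)) n k c : gen_elts a n0 -> (k <= n)%N ->
  c <= gen_at n0 k -> c <= gen_at (gen_map (maxn n) a n0) n.
Proof. by move=> en0 kn /(gen_map_at (maxn n) en0); rewrite (maxn_idPl kn). Qed.

(* [B] is one of [|X - Y| < eps] and [- eps < X - Y], and [R] its standard version.
   From [k] on, [max n n0] is an admissible index; it agrees with [n] on [n0 = k]. *)
Lemma bound_fromP a q p (eps : carrier (condRat A)) (n0 : carrier (condNat A))
    (B : carrier (condRat A) -> carrier (condRat A) -> Prop)
    (R : rat -> rat -> rat -> Prop) :
  seqfun a q -> seqfun a p -> gen_elts a eps -> gen_elts a n0 ->
  (forall X Y, gen_elts a X -> gen_elts a Y -> B X Y <->
     forall c z w e, \bot < c -> c <= gen_at X z -> c <= gen_at Y w ->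
       c <= gen_at eps e -> R e z w) ->
  (forall n : carrier (condNat A), condNat A a n -> nle a (n0, n) ->
    B (q a n) (p a n)) <->
  (forall c e k, \bot < c -> c <= gen_at eps e -> c <= gen_at n0 k ->
     holds_from (seq_at q a) (seq_at p a) (R e) k c).
Proof.
move=> fq fp eeps en0 BP; split=> [H c e k c0 ce ck n b z w kn b0 bc bz bw|H n en n0n].
  have em := gen_map_elts (maxn n) en0.
  have bm := gen_max_at en0 kn (le_trans bc ck).
  have HB := (BP _ _ (seqfun_elts fq (lexx a) em) (seqfun_elts fp (lexx a) em)).1
    (H _ em (nle_max n en0)).
  apply: (HB b z w e) => //.
  - by rewrite (seq_at_decided fq _ em bm).
  - by rewrite (seq_at_decided fp _ em bm).
  - exact: le_trans ce.
apply/BP; [exact: (seqfun_elts fq)|exact: (seqfun_elts fp)|move=> c z w e c0 cz cw ce].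
have ca := le_trans ce (part_le (part_gen_at eeps) e).
have [k [b [b0 bc bk]]] := part_decide (part_gen_at en0) c0 ca.
have [m [f [f0 fb fm]]] := part_decide (part_gen_at en) b0 (le_trans bc ca).
have fk := le_trans fb bk; have fc := le_trans fb bc.
have /gen_relP[_ _ km] := n0n.
apply: (H f e k f0 (le_trans fc ce) fk m f) => //.
- exact: km fk fm.
- by rewrite -(seq_at_decided fq _ en fm); exact: le_trans cz.
- by rewrite -(seq_at_decided fp _ en fm); exact: le_trans cw.
Qed.

(** The argument of [bound_fromP] with two independent indices, each replaced by its maximum with
    [n0]. *)
Lemma cauchy_fromP a q (eps : carrier (condRat A)) (n0 : carrier (condNat A)) :
  seqfun a q -> gen_elts a eps -> gen_elts a n0 ->
  (forall m n : carrier (condNat A), condNat A a m -> condNat A a n ->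
    nle a (n0, m) -> nle a (n0, n) ->
     qlt a (qabs a (qsub a (q a n) (q a m))) eps) <->
  (forall c e k, \bot < c -> c <= gen_at eps e -> c <= gen_at n0 k ->
     cauchy_from (seq_at q a) e k c).
Proof.
move=> fq eeps en0.
split=> [H c e k c0 ce ck m n b z w km kn b0 bc bz bw|H m n em en n0m n0n].
  have em := gen_map_elts (maxn m) en0; have en := gen_map_elts (maxn n) en0.
  have bm := gen_max_at en0 km (le_trans bc ck).
  have bn := gen_max_at en0 kn (le_trans bc ck).
  have := H _ _ em en (nle_max m en0) (nle_max n en0).
  move=> /(qdist_ltP (seqfun_elts fq (lexx a) en) (seqfun_elts fq (lexx a) em) eeps) D.
  apply: (D b) => //.
  - by rewrite (seq_at_decided fq _ en bn).
  - by rewrite (seq_at_decided fq _ em bm).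
  - exact: le_trans ce.
apply/(qdist_ltP (seqfun_elts fq (lexx a) en) (seqfun_elts fq (lexx a) em) eeps).
move=> c w z e c0 cw cz ce.
have ca := le_trans ce (part_le (part_gen_at eeps) e).
have [k [b [b0 bc bk]]] := part_decide (part_gen_at en0) c0 ca.
have [j [f [f0 fb fj]]] := part_decide (part_gen_at em) b0 (le_trans bc ca).
have [i [g [g0 gf gi]]] := part_decide (part_gen_at en) f0 (le_trans fb (le_trans bc
  ca)).
have gb := le_trans gf fb; have gj := le_trans gf fj; have gc := le_trans gb bc.
have /gen_relP[_ _ kj] := n0m; have /gen_relP[_ _ ki] := n0n.
apply: (H g e k g0 (le_trans gc ce) (le_trans gb bk) j i g) => //.
- exact: kj (le_trans gb bk) gj.
- exact: ki (le_trans gb bk) gi.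
- by rewrite -(seq_at_decided fq _ em gj); exact: le_trans cz.
- by rewrite -(seq_at_decided fq _ en gi); exact: le_trans cw.
Qed.

Lemma condCauchyP a q : condCauchy a q <-> seqfun a q /\ cauchy_on a (seq_at q a).
Proof.
have M := @mixing a (cauchy_from (seq_at q a)) (@cauchy_from_sub _)
  (@cauchy_from_dense _).
split=> [[fq cq]|[fq /M cq]]; split=> //.
  apply/M => eps eps0.
  have [eeps _] := eps0; have [n0 en0 H] := cq eps eps0.
  by exists n0 => //; apply: ((cauchy_fromP fq eeps en0).1 H).
move=> eps eps0; have [eeps _] := eps0; have [n0 en0 H] := cq eps eps0.
by exists n0 => //; apply: ((cauchy_fromP fq eeps en0).2 H).
Qed.

Lemma qseq_equivP a q p : seqfun a q -> seqfun a p ->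
  qseq_equiv a q p <-> close_on a (seq_at q a) (seq_at p a).
Proof.
move=> fq fp.
have M := @mixing a (fun e => holds_from (seq_at q a) (seq_at p a) (fun z w => `|z -
  w| < e)%R)
  (fun _ => @holds_from_sub _ _ _) (fun _ => @holds_from_dense _ _ _).
split=> [H|/M H eps eps0].
  apply/M => eps eps0; have [eeps _] := eps0; have [n0 en0 Hn] := H eps eps0.
  exists n0 => //; exact: ((bound_fromP fq fp eeps en0 (fun X Y eX eY => qdist_ltP eX
    eY eeps)).1 Hn).
have [eeps _] := eps0; have [n0 en0 Hn] := H eps eps0; exists n0 => //.
exact: ((bound_fromP fq fp eeps en0 (fun X Y eX eY => qdist_ltP eX eY eeps)).2 Hn).
Qed.

Lemma qseq_leP a p q : seqfun a p -> seqfun a q ->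
  qseq_le a p q <-> le_on a (seq_at p a) (seq_at q a).
Proof.
move=> fp fq.
have M := @mixing a (fun e => holds_from (seq_at q a) (seq_at p a) (fun z w => - e <
  z - w)%R)
  (fun _ => @holds_from_sub _ _ _) (fun _ => @holds_from_dense _ _ _).
split=> [H|/M H eps eps0].
  apply/M => eps eps0; have [eeps _] := eps0; have [n0 en0 Hn] := H eps eps0.
  exists n0 => //; exact: ((bound_fromP fq fp eeps en0 (fun X Y eX eY => qopp_lt_subP
    eX eY eeps)).1 Hn).
have [eeps _] := eps0; have [n0 en0 Hn] := H eps eps0; exists n0 => //.
exact: ((bound_fromP fq fp eeps en0 (fun X Y eX eY => qopp_lt_subP eX eY eeps)).2 Hn).
Qed.

(** * Arithmetic of names *)

Definition name a (v : nat -> rat -> A) := forall k, partition_of a (v k).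

Definition pointwise2 (f : rat -> rat -> rat) (v u t : nat -> rat -> A) :=
  forall k c z w, c <= v k z -> c <= u k w -> c <= t k (f z w).

Definition pointwise1 (f : rat -> rat) (v t : nat -> rat -> A) :=
  forall k c z, c <= v k z -> c <= t k (f z).

Lemma holds_from_imp v u (R R' : rat -> rat -> Prop) k c :
  (forall z w, R z w -> R' z w) -> holds_from v u R k c -> holds_from v u R' k c.
Proof. by move=> RR H n b z w kn b0 bc bz bw; apply/RR/(H n b). Qed.

Lemma name_decide a v n c : name a v -> \bot < c -> c <= a ->
  exists z b, [/\ \bot < b, b <= c & b <= v n z].
Proof. by move=> nv; apply: part_decide. Qed.

Lemma name_le a v n z : name a v -> v n z <= a.
Proof. by move=> nv; apply: part_le. Qed.

Lemma name_uniq a v n c z w : name a v -> \bot < c -> c <= v n z -> c <= v n w -> z = w.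
Proof. by move=> nv; apply: part_uniq. Qed.

(** Once both arguments are decided on a smaller condition, [t] takes the value [f x y] there, and a
    name takes at most one value on a nonzero condition. *)
Lemma pointwise2_inv a f v u t n c z : name a v -> name a u -> name a t ->
  pointwise2 f v u t -> \bot < c -> c <= t n z -> exists x y b,
  [/\ \bot < b, b <= c, b <= v n x, b <= u n y & z = f x y].
Proof.
move=> nv nu nt p c0 cz; have ca := le_trans cz (name_le n z nt).
have [x [b [b0 bc bx]]] := name_decide n nv c0 ca.
have [y [g [g0 gb gy]]] := name_decide n nu b0 (le_trans bc ca).
have gx := le_trans gb bx; exists x, y, g; split=> //; first exact: le_trans bc.
apply: (name_uniq nt g0) (p _ _ _ _ gx gy).
exact: le_trans (le_trans gb bc) cz.
Qed.

Lemma pointwise1_inv a f v t n c z : name a v -> name a t ->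
  pointwise1 f v t -> \bot < c -> c <= t n z -> exists x b,
  [/\ \bot < b, b <= c, b <= v n x & z = f x].
Proof.
move=> nv nt p c0 cz; have ca := le_trans cz (name_le n z nt).
have [x [b [b0 bc bx]]] := name_decide n nv c0 ca.
exists x, b; split=> //; apply: (name_uniq nt b0) (p _ _ _ bx).
exact: le_trans bc cz.
Qed.

Lemma close_on_eq a v u :
  (forall n c z w, \bot < c -> c <= v n z -> c <= u n w -> z = w) -> close_on a v u.
Proof.
move=> vu e e0 b b0 ba; exists b; split=> //; exists 0%N => n c z w _ c0 _ cz cw.
by rewrite (vu n c z w) // subrr normr0.
Qed.

Lemma close_on_sub a b v u : b <= a -> close_on a v u -> close_on b v u.
Proof. by move=> ba H e e0; apply: dense_sub ba _; exact: H. Qed.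

Lemma cauchy_on_sub a b v : b <= a -> cauchy_on a v -> cauchy_on b v.
Proof. by move=> ba H e e0; apply: dense_sub ba _; exact: H. Qed.

Lemma le_on_sub a b v u : b <= a -> le_on a v u -> le_on b v u.
Proof. by move=> ba H e e0; apply: dense_sub ba _; exact: H. Qed.

Lemma close_on_sym a v u : close_on a v u -> close_on a u v.
Proof.
move=> H e e0; apply: dense_imp (H e e0) => b _ _ [k Hk]; exists k.
by move=> n c z w kn c0 cb cz cw; rewrite distrC; exact: (Hk n c).
Qed.

(** The middle value [y] is found by shrinking the condition. The conclusion speaks of rationals
    alone, so it does not remember that the condition was shrunk; most estimates below use the same
    device. *)
Lemma eventually_trans a v u t (R R' : rat -> rat -> Prop) : name a u ->
  eventually a v u R -> eventually a u t R' ->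
  eventually a v t (fun z w => exists2 y, R z y & R' y w).
Proof.
move=> nu H H'; apply: dense_bind H => b b0 ba [k Hk].
apply: dense_imp (dense_sub ba H') => c c0 cb [k' Hk']; exists (maxn k k').
move=> n g z w; rewrite geq_max => /andP[kn k'n] g0 gc gz gw.
have [y [h [h0 hg hy]]] := name_decide n nu g0 (le_trans gc (le_trans cb ba)).
exists y.
  by apply: (Hk n h) => //; [exact: le_trans hg (le_trans gc cb)|exact: le_trans gz].
by apply: (Hk' n h) => //; [exact: le_trans gc|exact: le_trans gw].
Qed.

Lemma eventually_imp a v u (R R' : rat -> rat -> Prop) :
  (forall z w, R z w -> R' z w) -> eventually a v u R -> eventually a v u R'.
Proof.
move=> RR; apply: dense_imp => b _ _ [k Hk]; exists k; exact: holds_from_imp Hk.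
Qed.

Lemma close_on_trans a v u t : name a u ->
  close_on a v u -> close_on a u t -> close_on a v t.
Proof.
move=> nu H H' e e0; have e2 : (0 < e / 2)%R by lra.
apply: eventually_imp (eventually_trans nu (H _ e2) (H' _ e2)) => z w [y].
by rewrite !ltr_norml => /andP[? ?] /andP[? ?]; apply/andP; split; lra.
Qed.

Lemma le_on_trans a v u t : name a u -> le_on a v u -> le_on a u t -> le_on a v t.
Proof.
move=> nu H H' e e0; have e2 : (0 < e / 2)%R by lra.
apply: eventually_imp (eventually_trans nu (H' _ e2) (H _ e2)) => z w [y] ? ?; lra.
Qed.

Lemma close_le_on a v u : close_on a v u -> le_on a v u.
Proof.
move=> /close_on_sym H e e0; apply: eventually_imp (H e e0) => z w.
by rewrite ltr_norml => /andP[].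
Qed.

Lemma le_on_anti a v u : le_on a v u -> le_on a u v -> close_on a v u.
Proof.
move=> H H' e e0; apply: dense_bind (H e e0) => b b0 ba [k Hk].
apply: dense_imp (dense_sub ba (H' e e0)) => c c0 cb [k' Hk']; exists (maxn k k').
move=> n g z w; rewrite geq_max => /andP[kn k'n] g0 gc gz gw.
have ? := Hk n g w z kn g0 (le_trans gc cb) gw gz.
have ? := Hk' n g z w k'n g0 gc gz gw.
by rewrite ltr_norml; apply/andP; split; lra.
Qed.

Definition bounded_from (v : nat -> rat -> A) (M : rat) k c :=
  forall n b z, (k <= n)%N -> \bot < b -> b <= c -> b <= v n z -> (`|z| <= M)%R.

(** The classical bound [|x| + 1], with [x] the [k]-th term. As [x] is known only on a condition
    that decides it, the bound exists densely and may vary with the condition. *)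
Lemma cauchy_bounded a v : name a v -> cauchy_on a v ->
  dense a (fun b => exists M k, (0 < M)%R /\ bounded_from v M k b).
Proof.
move=> nv cv b b0 ba; have [c [c0 cb [k Hk]]] := cv 1%R ltr01 b b0 ba.
have [x [g [g0 gc gx]]] := name_decide k nv c0 (le_trans cb ba).
exists g; split=> //; first exact: le_trans cb.
exists (`|x| + 1)%R, k; split; first by have := normr_ge0 x; lra.
move=> n h z kn h0 hg hz.
have D := Hk k n h x z (leqnn k) kn h0 (le_trans hg gc) (le_trans hg gx) hz.
have := ler_normD x (z - x)%R; rewrite addrC subrK; lra.
Qed.

(** The chosen splitting of the difference needs bounds on [x] and [y'] only. Accordingly
    [close_mul] asks just one sequence of each equivalent pair to be Cauchy. *)
Lemma prod_close (M e x y x' y' : rat) : (0 < M)%R -> (`|x| <= M)%R -> (`|y'| <= M)%R ->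
  (`|x - x'| < e / (2 * M))%R -> (`|y - y'| < e / (2 * M))%R ->
  (`|x * y - x' * y'| < e)%R.
Proof.
move=> M0 xM yM; rewrite !ltr_pdivlMr ?mulr_gt0 // => xx yy.
have -> : (x * y - x' * y' = x * (y - y') + (x - x') * y')%R by ring.
have := ler_normD (x * (y - y'))%R ((x - x') * y')%R; rewrite !normrM => D.
have : (`|x| * `|y - y'| <= M * `|y - y'|)%R by rewrite ler_wpM2r.
have : (`|x - x'| * `|y'| <= `|x - x'| * M)%R by rewrite ler_wpM2l.
lra.
Qed.

Lemma add_close (e x y x' y' : rat) : (`|x - x'| < e / 2)%R -> (`|y - y'| < e / 2)%R ->
  (`|x + y - (x' + y')| < e)%R.
Proof.
by rewrite !ltr_norml => /andP[? ?] /andP[? ?]; apply/andP; split; lra.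
Qed.

Section Operations.
Context (a : A) (v u t v' u' t' : nat -> rat -> A).
Context (nv : name a v) (nu : name a u) (nt : name a t).
Context (nv' : name a v') (nu' : name a u') (nt' : name a t').

Lemma cauchy_add : pointwise2 +%R v u t ->
  cauchy_on a v -> cauchy_on a u -> cauchy_on a t.
Proof.
move=> p cv cu e e0; have e2 : (0 < e / 2)%R by lra.
apply: dense_bind (cv _ e2) => b b0 ba [k Hk].
apply: dense_imp (dense_sub ba (cu _ e2)) => c c0 cb [k' Hk']; exists (maxn k k').
move=> m n g z w; rewrite !geq_max => /andP[km k'm] /andP[kn k'n] g0 gc gz gw.
have [x [y [h [h0 hg hx hy ->]]]] := pointwise2_inv nv nu nt p g0 gz.
have [x' [y' [i [i0 ih ix iy ->]]]] := pointwise2_inv nv nu nt p h0 (le_trans hg gw).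
have ic := le_trans ih (le_trans hg gc).
apply: add_close.
  by apply: (Hk m n i) => //; [exact: le_trans cb|exact: le_trans hx].
by apply: (Hk' m n i) => //; exact: le_trans hy.
Qed.

Lemma cauchy_mul : pointwise2 *%R v u t ->
  cauchy_on a v -> cauchy_on a u -> cauchy_on a t.
Proof.
move=> p cv cu e e0.
apply: dense_bind (cauchy_bounded nv cv) => b b0 ba [M [k [M0 Mv]]].
apply: dense_bind (dense_sub ba (cauchy_bounded nu cu)) => c c0 cb [M' [k' [M'0 Mu]]].
have ca := le_trans cb ba; set N := (M + M')%R.
have MN : (M <= N)%R by rewrite /N; lra.
have M'N : (M' <= N)%R by rewrite /N; lra.
have N0 : (0 < N)%R by rewrite /N; lra.
have eN : (0 < e / (2 * N))%R by rewrite divr_gt0 // mulr_gt0.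
apply: dense_bind (dense_sub ca (cv _ eN)) => f f0 fc [l Hl].
apply: dense_imp (dense_sub (le_trans fc ca) (cu _ eN)) => g g0 gf [l' Hl'].
exists (maxn (maxn k k') (maxn l l')) => m n h z w.
rewrite !geq_max => /andP[/andP[km k'm] /andP[lm l'm]].
move=> /andP[/andP[kn k'n] /andP[ln l'n]] h0 hg hz hw.
have [x [y [i [i0 ih ix iy ->]]]] := pointwise2_inv nv nu nt p h0 hz.
have [x' [y' [j [j0 ji jx jy ->]]]] := pointwise2_inv nv nu nt p i0 (le_trans ih hw).
have jg := le_trans ji (le_trans ih hg); have jc := le_trans jg (le_trans gf fc).
apply: (prod_close N0).
- by apply: le_trans MN; apply: (Mv n j) => //; exact: le_trans cb.
- by apply: le_trans M'N; apply: (Mu m j) => //; exact: le_trans iy.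
- by apply: (Hl m n j) => //; [exact: le_trans gf|exact: le_trans ix].
- by apply: (Hl' m n j) => //; exact: le_trans iy.
Qed.

Lemma close_add : pointwise2 +%R v u t -> pointwise2 +%R v' u' t' ->
  close_on a v v' -> close_on a u u' -> close_on a t t'.
Proof.
move=> p p' cv cu e e0; have e2 : (0 < e / 2)%R by lra.
apply: dense_bind (cv _ e2) => b b0 ba [k Hk].
apply: dense_imp (dense_sub ba (cu _ e2)) => c c0 cb [k' Hk']; exists (maxn k k').
move=> n g z w; rewrite !geq_max => /andP[kn k'n] g0 gc gz gw.
have [x [y [h [h0 hg hx hy ->]]]] := pointwise2_inv nv nu nt p g0 gz.
have [x' [y' [i [i0 ih ix iy ->]]]] :=
  pointwise2_inv nv' nu' nt' p' h0 (le_trans hg gw).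
have ic := le_trans ih (le_trans hg gc).
apply: add_close.
  by apply: (Hk n i) => //; [exact: le_trans cb|exact: le_trans hx].
by apply: (Hk' n i) => //; exact: le_trans hy.
Qed.

Lemma close_mul : pointwise2 *%R v u t -> pointwise2 *%R v' u' t' ->
  cauchy_on a v -> cauchy_on a u' ->
  close_on a v v' -> close_on a u u' -> close_on a t t'.
Proof.
move=> p p' bv bu' cv cu e e0.
apply: dense_bind (cauchy_bounded nv bv) => b b0 ba [M [k [M0 Mv]]].
apply: dense_bind (dense_sub ba (cauchy_bounded nu' bu')) => c c0 cb [M' [k' [M'0 Mu]]].
have ca := le_trans cb ba; set N := (M + M')%R.
have MN : (M <= N)%R by rewrite /N; lra.
have M'N : (M' <= N)%R by rewrite /N; lra.
have N0 : (0 < N)%R by rewrite /N; lra.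
have eN : (0 < e / (2 * N))%R by rewrite divr_gt0 // mulr_gt0.
apply: dense_bind (dense_sub ca (cv _ eN)) => f f0 fc [l Hl].
apply: dense_imp (dense_sub (le_trans fc ca) (cu _ eN)) => g g0 gf [l' Hl'].
exists (maxn (maxn k k') (maxn l l')) => n h z w.
rewrite !geq_max => /andP[/andP[kn k'n] /andP[ln l'n]] h0 hg hz hw.
have [x [y [i [i0 ih ix iy ->]]]] := pointwise2_inv nv nu nt p h0 hz.
have [x' [y' [j [j0 ji jx jy ->]]]] :=
  pointwise2_inv nv' nu' nt' p' i0 (le_trans ih hw).
have jg := le_trans ji (le_trans ih hg); have jc := le_trans jg (le_trans gf fc).
apply: (prod_close N0).
- by apply: le_trans MN; apply: (Mv n j) => //; [exact: le_trans cb|exact: le_trans ix].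
- by apply: le_trans M'N; apply: (Mu n j).
- by apply: (Hl n j) => //; [exact: le_trans gf|exact: le_trans ix].
- by apply: (Hl' n j) => //; exact: le_trans iy.
Qed.

Lemma cauchy_opp : pointwise1 (fun x => - x)%R v t -> cauchy_on a v -> cauchy_on a t.
Proof.
move=> p cv e e0; apply: dense_imp (cv _ e0) => b b0 ba [k Hk]; exists k.
move=> m n g z w km kn g0 gb gz gw.
have [x [h [h0 hg hx ->]]] := pointwise1_inv nv nt p g0 gz.
have [y [i [i0 ih iy ->]]] := pointwise1_inv nv nt p h0 (le_trans hg gw).
rewrite -opprD normrN; apply: (Hk m n i) => //; last exact: le_trans hx.
exact: le_trans ih (le_trans hg gb).
Qed.

End Operations.

(** * Strict order and inverses of names *)

Definition lt_from (v u : nat -> rat -> A) c :=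
  exists e k, (0 < e)%R /\ holds_from v u (fun z w => e <= w - z)%R k c.

Definition lt_on a (v u : nat -> rat -> A) := dense a (lt_from v u).

(** Failure of closeness gives [e] and a condition below which the names are nowhere eventually
    [e]-close. Past an index from which both vary by less than [e / 4], one decided pair at distance
    at least [e] forces the whole tail to stay at least [e / 2] apart with the same sign. *)
Lemma not_close_on a a' v u : name a v -> name a u -> cauchy_on a v -> cauchy_on a u ->
  a' <= a -> ~ close_on a' v u ->
  exists c, [/\ \bot < c, c <= a' & lt_from v u c \/ lt_from u v c].
Proof.
move=> nv nu cv cu a'a /existsNP[e /not_implyP[e0 /existsNP[b]]].
move=> /not_implyP[b0 /not_implyP[ba' nb]]; have ba := le_trans ba' a'a.
have e4 : (0 < e / 4)%R by lra.
have [c [c0 cb [k Hk]]] := cv _ e4 b b0 ba.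
have [g [g0 gc [k' Hk']]] := cu _ e4 c c0 (le_trans cb ba).
apply: contrapT => nlt; apply: nb; exists g; split=> //; first exact: le_trans cb.
exists (maxn k k') => n h z w; rewrite geq_max => /andP[kn k'n] h0 hg hz hw.
rewrite ltNge; apply/negP => ezw; apply: nlt; exists h; split=> //.
  exact: le_trans hg (le_trans gc (le_trans cb ba')).
have near m i x y : (n <= m)%N -> \bot < i -> i <= h -> i <= v m x -> i <= u m y ->
    (`|x - z| < e / 4)%R /\ (`|y - w| < e / 4)%R.
  move=> nm i0 ih ix iy; split.
    apply: (Hk n m i) => //; [exact: leq_trans nm|exact: le_trans ih (le_trans hg gc)|].
    exact: le_trans ih hz.
  apply: (Hk' n m i) => //; [exact: leq_trans nm|exact: le_trans ih hg|].
  exact: le_trans ih hw.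
have e2 : (0 < e / 2)%R by lra.
move: ezw; rewrite ler_normr => /orP[] ezw; [right|left]; exists (e / 2)%R, n;
  split=> // m i x y nm i0 ih ix iy.
- have [] := near m i y x nm i0 ih iy ix.
  by rewrite !ltr_norml => /andP[? ?] /andP[? ?]; lra.
- have [] := near m i x y nm i0 ih ix iy.
  by rewrite !ltr_norml => /andP[? ?] /andP[? ?]; lra.
Qed.

Lemma lt_from_sub v u b c : b <= c -> lt_from v u c -> lt_from v u b.
Proof.
by move=> bc [e [k [e0 H]]]; exists e, k; split=> //; exact: holds_from_sub H.
Qed.

Lemma lt_on_le a v u : lt_on a v u -> le_on a v u.
Proof.
move=> H e e0; apply: dense_imp H => b b0 ba [e' [k [e'0 Hk]]]; exists k.
move=> n c z w kn c0 cb cz cw; have := Hk n c w z kn c0 cb cw cz; lra.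
Qed.

(** [holds_from] is vacuous where values are undecided. To contradict it, an actual pair of values
    has to be produced at some late index. *)
Lemma holds_from_inhabited a v u (R : rat -> rat -> Prop) k c n : name a v ->
  name a u ->
  \bot < c -> c <= a -> (k <= n)%N -> holds_from v u R k c ->
  exists b z w, [/\ \bot < b, b <= c, b <= v n z, b <= u n w & R z w].
Proof.
move=> nv nu c0 ca kn H; have [z [b [b0 bc bz]]] := name_decide n nv c0 ca.
have [w [g [g0 gb gw]]] := name_decide n nu b0 (le_trans bc ca).
have gc := le_trans gb bc; have gz := le_trans gb bz.
by exists g, z, w; split=> //; exact: (H n g).
Qed.

Lemma lt_on_not_close a b v u : name a v -> name a u -> lt_on a v u ->
  b <= a -> \bot < b -> ~ close_on b v u.
Proof.
move=> nv nu lt ba b0 cl; have [c [c0 cb [e [k [e0 Hk]]]]] := lt b b0 ba.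
have [g [g0 gc [k' Hk']]] := cl e e0 c c0 cb.
have [|h [z [w [h0 hg hz hw zw]]]] :=
  @holds_from_inhabited a v u _ k' g (maxn k k') nv nu g0 _ (leq_maxr _ _) Hk'.
  exact: le_trans gc (le_trans cb ba).
have := Hk _ h z w (leq_maxl _ _) h0 (le_trans hg gc) hz hw.
move: zw; rewrite ltr_norml => /andP[? ?]; lra.
Qed.

(** By the dichotomy some smaller condition separates the names; separation with the wrong sign by
    [e] contradicts [le_on] for that same [e]. *)
Lemma le_on_lt a v u : name a v -> name a u -> cauchy_on a v -> cauchy_on a u ->
  le_on a v u -> (forall b, \bot < b -> b <= a -> ~ close_on b v u) -> lt_on a v u.
Proof.
move=> nv nu cv cu vu ncl b b0 ba.
have [c [c0 cb [lt|[e [k [e0 Hk]]]]]] := not_close_on nv nu cv cu ba (ncl b b0 ba).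
  by exists c.
have ca := le_trans cb ba; have [g [g0 gc [k' Hk']]] := vu e e0 c c0 ca.
have [|h [z [w [h0 hg hz hw zw]]]] :=
  @holds_from_inhabited a u v _ k' g (maxn k k') nu nv g0 _ (leq_maxr _ _) Hk'.
  exact: le_trans gc ca.
have := Hk _ h z w (leq_maxl _ _) h0 (le_trans hg gc) hz hw; lra.
Qed.

Definition apart_from (v : nat -> rat -> A) c := exists e k, (0 < e)%R /\
  forall n b z, (k <= n)%N -> \bot < b -> b <= c -> b <= v n z -> (e <= `|z|)%R.

Section Zero.
Context (a : A) (o : nat -> rat -> A) (no : name a o).
Context (o0 : forall n c z, \bot < c -> c <= o n z -> z = 0%R).

Lemma cauchy_const : cauchy_on a o.
Proof.
move=> e e0; apply: dense_all => b b0 ba; exists 0%N.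
move=> m n c z w _ _ c0 cb /(o0 c0)-> /(o0 c0)->.
by rewrite subrr normr0.
Qed.

Lemma not_zero_apart v : name a v -> cauchy_on a v ->
  (forall b, \bot < b -> b <= a -> ~ close_on b v o) -> dense a (apart_from v).
Proof.
move=> nv cv ncl b b0 ba.
have [c [c0 cb lt]] := not_close_on nv no cv cauchy_const ba (ncl b b0 ba).
exists c; split=> //; case: lt => -[e [k [e0 H]]]; exists e, k;
  split=> // n g z kn g0 gc gz.
all: have [y [h [h0 hg hy]]] := name_decide n no g0 (le_trans gc (le_trans cb ba)).
all: have hc := le_trans hg gc; have hz := le_trans hg gz; have yE := o0 h0 hy.
- by have := H n h z y kn h0 hc hz hy; rewrite yE sub0r -normrN => /le_trans; apply;
    exact: ler_norm.
- by have := H n h y z kn h0 hc hy hz; rewrite yE subr0 => /le_trans; apply;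
    exact: ler_norm.
Qed.

Lemma lt_on_mul v u t : name a v -> name a u -> name a t -> pointwise2 *%R v u t ->
  lt_on a o v -> lt_on a o u -> lt_on a o t.
Proof.
move=> nv nu nt p ov ou; apply: dense_bind ov => b b0 ba [e [k [e0 H]]].
apply: dense_imp (dense_sub ba ou) => c c0 cb [e' [k' [e'0 H']]].
exists (e * e')%R, (maxn k k'); split; first exact: mulr_gt0.
move=> n g z w; rewrite geq_max => /andP[kn k'n] g0 gc gz gw.
have zE := o0 g0 gz; subst z.
have [x [y [h [h0 hg hx hy ->]]]] := pointwise2_inv nv nu nt p g0 gw.
have ho := le_trans hg gz; have hc := le_trans hg gc.
have := H n h _ x kn h0 (le_trans hc cb) ho hx.
have := H' n h _ y k'n h0 hc ho hy.
rewrite !subr0 => ey ex; apply: ler_pM => //; exact: ltW.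
Qed.

End Zero.

Lemma lt_on_add a v u r s t : name a v -> name a u -> name a r -> name a s ->
  name a t ->
  pointwise2 +%R v r s -> pointwise2 +%R u r t -> lt_on a v u -> lt_on a s t.
Proof.
move=> nv nu nr ns nt p p'; apply: dense_imp => b b0 ba [e [k [e0 H]]].
exists e, k; split=> // n c z w kn c0 cb cz cw.
have [x [y [h [h0 hc hx hy ->]]]] := pointwise2_inv nv nr ns p c0 cz.
have [x' [y' [i [i0 ih ix iy ->]]]] := pointwise2_inv nu nr nt p' h0 (le_trans hc cw).
have := H n i x x' kn i0 (le_trans ih (le_trans hc cb)) (le_trans ih hx) ix.
rewrite (name_uniq nr i0 (le_trans ih hy) iy); lra.
Qed.

Lemma inv_close (e D x y : rat) : (0 < D)%R -> (D <= `|x|)%R -> (D <= `|y|)%R ->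
  (`|x - y| < e * (D * D))%R -> (`|x^-1 - y^-1| < e)%R.
Proof.
move=> D0 Dx Dy xy; have x0 : (0 < `|x|)%R by exact: lt_le_trans Dx.
have y0 : (0 < `|y|)%R by exact: lt_le_trans Dy.
have xn : (x != 0)%R by rewrite -normr_gt0.
have yn : (y != 0)%R by rewrite -normr_gt0.
have -> : (x^-1 - y^-1 = (y - x) / (x * y))%R by field; rewrite xn yn.
rewrite normrM normfV normrM distrC ltr_pdivrMr ?mulr_gt0 //.
apply: (lt_le_trans xy); apply: ler_wpM2l.
  (* The sign of [e] comes from the hypothesis, which puts a nonnegative number below
     [e * (D * D)]. *)
  have : (0 < e * (D * D))%R by apply: le_lt_trans xy; exact: normr_ge0.
  by rewrite pmulr_lgt0 ?mulr_gt0 // => /ltW.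
by apply: ler_pM => //; exact: ltW.
Qed.

(** A zero term is inverted to zero. This is harmless because [apart_from] keeps a tail away from
    zero, densely, with its own [D] and [k]. *)
Lemma cauchy_inv a v t : name a v -> name a t -> pointwise1 GRing.inv v t ->
  cauchy_on a v -> dense a (apart_from v) -> cauchy_on a t.
Proof.
move=> nv nt p cv av e e0; apply: dense_bind av => b b0 ba [D [k [D0 H]]].
have eD : (0 < e * (D * D))%R by rewrite !mulr_gt0.
apply: dense_imp (dense_sub ba (cv _ eD)) => c c0 cb [k' Hk']; exists (maxn k k').
move=> m n g z w; rewrite !geq_max => /andP[km k'm] /andP[kn k'n] g0 gc gz gw.
have [x [h [h0 hg hx ->]]] := pointwise1_inv nv nt p g0 gz.
have [y [i [i0 ih iy ->]]] := pointwise1_inv nv nt p h0 (le_trans hg gw).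
have ic := le_trans ih (le_trans hg gc); have ix := le_trans ih hx.
apply: (inv_close D0).
- by apply: (H n i) => //; exact: le_trans cb.
- by apply: (H m i) => //; exact: le_trans cb.
- exact: (Hk' m n i).
Qed.

Lemma close_mul_inv a v t s u : name a v -> name a t -> name a s ->
  pointwise1 GRing.inv v t -> pointwise2 *%R v t s ->
  (forall n c z, \bot < c -> c <= u n z -> z = 1%R) ->
  dense a (apart_from v) -> close_on a s u.
Proof.
move=> nv nt ns p p2 u1 av e e0; apply: dense_imp av => b b0 ba [D [k [D0 H]]].
exists k => n c z w kn c0 cb cz cw; rewrite (u1 n c w c0 cw).
have [x [y [h [h0 hc hx hy ->]]]] := pointwise2_inv nv nt ns p2 c0 cz.
rewrite (name_uniq nt h0 hy (p _ _ _ hx)) divff ?subrr ?normr0 //.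
rewrite -normr_gt0; apply: lt_le_trans D0 _.
by apply: (H n h) => //; exact: le_trans cb.
Qed.

(** * Gluing conditional sequences *)

(** One sequence has different names on [a] and on a smaller [b], but they cannot be told apart
    below [b], and the notions on names only look below their condition. *)
Definition same_below a (v u : nat -> rat -> A) :=
  forall c k z, c <= a -> (c <= v k z) = (c <= u k z).

Lemma cauchy_on_same a v u : same_below a v u -> cauchy_on a v -> cauchy_on a u.
Proof.
move=> vu cv e e0; apply: dense_imp (cv e e0) => b _ ba [k H]; exists k.
move=> m n c z w km kn c0 cb; have ca := le_trans cb ba.
by rewrite -!vu //; exact: H.
Qed.

Section SameBelow.
Context (a : A) (v v' u u' : nat -> rat -> A).
Context (vv : same_below a v v') (uu : same_below a u u').

Lemma holds_from_same R k b : b <= a -> holds_from v u R k b -> holds_from v' u' R k b.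
Proof.
move=> ba H n c z w kn c0 cb; have ca := le_trans cb ba.
by rewrite -vv // -uu //; exact: H.
Qed.

Lemma eventually_same R : eventually a v u R -> eventually a v' u' R.
Proof.
by apply: dense_imp => b _ ba [k H]; exists k; exact: holds_from_same.
Qed.

Lemma close_on_same : close_on a v u -> close_on a v' u'.
Proof. by move=> H e e0; apply: eventually_same; exact: H. Qed.

Lemma lt_on_same : lt_on a v u -> lt_on a v' u'.
Proof.
apply: dense_imp => b _ ba [e [k [e0 H]]]; exists e, k; split=> //.
exact: holds_from_same H.
Qed.

End SameBelow.

Lemma le_on_same a v v' u u' : same_below a v v' -> same_below a u u' ->
  le_on a v u -> le_on a v' u'.
Proof. by move=> vv uu H e e0; apply: eventually_same uu vv _ (H e e0). Qed.

Lemma same_below_sym a v u : same_below a v u -> same_below a u v.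
Proof. by move=> vu c k z ca; rewrite vu. Qed.

Lemma same_below_seq_at a b q : seqfun a q -> b <= a ->
  same_below b (seq_at q b) (seq_at q a).
Proof. by move=> fq ba c k z cb; rewrite (seq_at_restr fq _ _ ba) lexI cb. Qed.

Section SequenceOperations.
Context (a : A).

(** [qseq_add] and [qseq_mul] are instances up to conversion. *)
Definition qseq_map2 (f : rat -> rat -> rat) (q p : qseq A) : qseq A :=
  fun b x => gen_map2 f b (q b x) (p b x).

Definition qseq_map (f : rat -> rat) (q : qseq A) : qseq A :=
  fun b x => gen_map f b (q b x).

Lemma seqfun_map2 f q p : seqfun a q -> seqfun a p -> seqfun a (qseq_map2 f q p).
Proof.
move=> fq fp; apply/seqfunP; split=> b n ba en.
  by apply: gen_map2_elts; [exact: (seqfun_elts fq)|exact: (seqfun_elts fp)].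
rewrite /qseq_map2 (seqfun_gam fq ba en) (seqfun_gam fp ba en).
by rewrite -(gam_map2 f (seqfun_elts fq (lexx a) en) (seqfun_elts fp (lexx a) en) ba).
Qed.

Lemma seqfun_map f q : seqfun a q -> seqfun a (qseq_map f q).
Proof.
move=> fq; apply/seqfunP; split=> b n ba en.
  by apply: gen_map_elts; exact: (seqfun_elts fq).
rewrite /qseq_map (seqfun_gam fq ba en).
by rewrite -(gam_map f (seqfun_elts fq (lexx a) en) ba).
Qed.

Lemma pointwise_map2 f q p : seqfun a q -> seqfun a p ->
  pointwise2 f (seq_at q a) (seq_at p a) (seq_at (qseq_map2 f q p) a).
Proof.
move=> fq fp k c z w cz cw; have ek := gen_const_elts a k.
by apply: gen_map2_at => //; [exact: (seqfun_elts fq)|exact: (seqfun_elts fp)].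
Qed.

Lemma pointwise_map f q : seqfun a q ->
  pointwise1 f (seq_at q a) (seq_at (qseq_map f q) a).
Proof.
move=> fq k c z cz; have ek := gen_const_elts a k.
by apply: gen_map_at => //; exact: (seqfun_elts fq).
Qed.

Lemma seqfun_const z : seqfun a (qseq_const z).
Proof.
apply/seqfunP; split=> b n ba en; first exact: gen_const_elts.
by rewrite /qseq_const (gam_const z ba).
Qed.

Lemma seq_at_const z k c w : \bot < c -> c <= seq_at (qseq_const z) a k w -> w = z.
Proof.
move=> c0 cw; have ez := gen_const_elts a z.
have ca := le_trans cw (part_le (part_gen_at ez) w).
by apply: (part_uniq (part_gen_at ez) c0 cw); exact: gen_const_at.
Qed.

Lemma condCauchy_const z : condCauchy a (qseq_const z).
Proof.
apply/condCauchyP; split=> [|e e0]; first exact: seqfun_const.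
apply: dense_all => b b0 ba; exists 0%N => m n c x y _ _ c0 cb.
by move=> /(seq_at_const c0)-> /(seq_at_const c0)->; rewrite subrr normr0.
Qed.

End SequenceOperations.

(* The sequence whose value at a conditional index is found by evaluating the
   name piecewise along the partition given by the index. *)
Definition name_seq (v : nat -> rat -> A) : qseq A :=
  fun b x => gen_mk b (glue (fun k z => gen_at x k `&` v k z)).

Section NameSeq.
Context (a : A) (v : nat -> rat -> A) (nv : name a v).

Lemma part_name_seq b (n : carrier (condNat A)) : b <= a -> gen_elts b n ->
  partition_of b (glue (fun k z => gen_at n k `&` v k z)).
Proof.
move=> ba en; apply: (part_glue (part_gen_at en)) => k; apply: (part_restr (nv k)).
exact: le_trans (part_le (part_gen_at en) k) ba.
Qed.

Lemma seqfun_name_seq : seqfun a (name_seq v).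
Proof.
apply/seqfunP; split=> b n ba en; first exact/gen_mk_elts/part_name_seq.
have pa := part_name_seq (lexx a) en.
have en' := gam_elts en ba; have pb := part_name_seq ba en'.
apply: (gen_ext (gen_mk_elts pb) (gam_elts (gen_mk_elts pa) ba)) => c z w c0.
rewrite (gam_at _ (gen_mk_elts pa) ba) (gen_mk_at pb) (gen_mk_at pa) lexI.
move=> cz /andP[cb cw].
have [e [e0 ec [k]]] := glue_dense cz c0 (lexx _); rewrite lexI => /andP[ek ez].
have [g [g0 ge [m]]] := glue_dense (le_trans ec cw) e0 (lexx _).
rewrite lexI => /andP[gm gw].
move: ek; rewrite (gam_at _ en ba) lexI => /andP[_ ek].
move: gw; rewrite -(part_uniq (part_gen_at en) g0 (le_trans ge ek) gm).
exact: name_uniq nv g0 (le_trans ge ez).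
Qed.

Lemma seq_at_name_seq k z : seq_at (name_seq v) a k z = v k z.
Proof.
have ek := gen_const_elts a k; have pa := part_name_seq (lexx a) ek.
rewrite /seq_at (gen_mk_at pa).
have pk j : partition_of (gen_at (gen_const a k) j)
    (fun z => gen_at (gen_const a k) j `&` v j z).
  by apply: (part_restr (nv j)); exact: part_le (part_gen_at ek) j.
have := glue_restr k z (part_gen_at ek) pk; have ak := gen_const_at k (lexx a).
by rewrite !meet_r ?(le_trans (part_le pa z) ak) ?(le_trans (part_le (nv k) z) ak).
Qed.

End NameSeq.

Lemma condCauchy_sub a b q : b <= a -> condCauchy a q -> condCauchy b q.
Proof.
move=> ba /condCauchyP[fq cq]; apply/condCauchyP; split;
  first exact: (seqfun_restr fq ba).
apply: (cauchy_on_same (same_below_sym (same_below_seq_at fq ba))).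
exact: cauchy_on_sub cq.
Qed.

(** The names are mixed term by term, and [name_seq] turns the mixture back into a sequence. Being
    Cauchy is a density statement, so it can be checked piece by piece, each piece with its own
    indices. *)
Lemma cauchy_glue (I : Type) (s : I -> A) (q : I -> qseq A) :
  partition_of \top s -> (forall i, condCauchy (s i) (q i)) ->
  exists Q, condCauchy \top Q /\ forall i,
    close_on (s i) (seq_at Q (s i)) (seq_at (q i) (s i)).
Proof.
move=> ps cq; pose v k := glue (fun i => seq_at (q i) (s i) k).
have fq i : seqfun (s i) (q i) by have /condCauchyP[] := cq i.
have pq k i : partition_of (s i) (seq_at (q i) (s i) k) by exact: part_seq_at.
have nv : name \top v by move=> k; exact: (part_glue ps (pq k)).
have sv i : same_below (s i) (seq_at (q i) (s i)) (seq_at (name_seq v) \top).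
  move=> c k z cs; rewrite (seq_at_name_seq nv) -(glue_restr i z ps (pq k)).
  by rewrite lexI cs.
have fQ := seqfun_name_seq nv; exists (name_seq v); split.
  apply/condCauchyP; split=> // e e0; apply: (dense_partition ps) => i.
  by have /condCauchyP[_ /(cauchy_on_same (sv i)) H] := cq i; apply: H.
move=> i; apply: close_on_eq => n c z w c0 cz cw.
apply: (name_uniq (a := s i) (pq^~ i) c0 _ cw); rewrite sv.
  rewrite -(same_below_seq_at fQ (lex1 (s i))) //.
  exact: (le_trans cz (part_le (part_seq_at (seqfun_restr fQ (lex1 _)) n) z)).
exact: (le_trans cw (part_le (pq n i) w)).
Qed.

Lemma close_on_partition (I : Type) a (s : I -> A) v u : partition_of a s ->
  (forall i, close_on (s i) v u) -> close_on a v u.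
Proof. by move=> ps H e e0; apply: (dense_partition ps) => i; exact: H. Qed.

Lemma le_on_partition (I : Type) a (s : I -> A) v u : partition_of a s ->
  (forall i, le_on (s i) v u) -> le_on a v u.
Proof. by move=> ps H e e0; apply: (dense_partition ps) => i; exact: H. Qed.

(** * The conditional real numbers *)

Definition close a (q p : qseq A) := close_on a (seq_at q a) (seq_at p a).

Lemma condCauchy_fun a q : condCauchy a q -> seqfun a q.
Proof. by case/condCauchyP. Qed.

Lemma condCauchy_name a q : condCauchy a q -> name a (seq_at q a).
Proof. by move=> /condCauchy_fun fq k; exact: part_seq_at. Qed.

Lemma condCauchy_cauchy a q : condCauchy a q -> cauchy_on a (seq_at q a).
Proof. by case/condCauchyP. Qed.

Lemma close_equiv a q p : condCauchy a q -> condCauchy a p ->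
  qseq_equiv a q p <-> close a q p.
Proof. by move=> /condCauchy_fun fq /condCauchy_fun fp; exact: qseq_equivP. Qed.

Lemma close_refl a q : condCauchy a q -> close a q q.
Proof.
move=> cq; apply: close_on_eq => n c z w; exact: name_uniq (condCauchy_name cq).
Qed.

Lemma close_trans a q p r : condCauchy a p -> close a q p -> close a p r -> close a q r.
Proof. by move=> cp; exact: close_on_trans (condCauchy_name cp). Qed.

Lemma close_below a b q p : condCauchy a q -> condCauchy a p -> b <= a ->
  close b q p <-> close_on b (seq_at q a) (seq_at p a).
Proof.
move=> /condCauchy_fun fq /condCauchy_fun fp ba.
have sq := same_below_seq_at fq ba; have sp := same_below_seq_at fp ba.
by split; apply: close_on_same => //; exact: same_below_sym.
Qed.

Lemma close_sub a b q p : condCauchy a q -> condCauchy a p -> b <= a ->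
  close a q p -> close b q p.
Proof. by move=> cq cp ba H; apply/(close_below cq cp ba)/(close_on_sub ba). Qed.

Lemma close_partition a (I : Type) (s : I -> A) q p : condCauchy a q ->
  condCauchy a p ->
  partition_of a s -> (forall i, close (s i) q p) -> close a q p.
Proof.
move=> cq cp ps H; apply: (close_on_partition ps) => i.
by apply/(close_below cq cp (part_le ps i)).
Qed.

Lemma real_class_eq a q p : condCauchy a q -> condCauchy a p ->
  real_class a q = real_class a p <-> close a q p.
Proof.
move=> cq cp; split=> [E|qp].
  have : real_class a p p by split=> //; apply/close_equiv => //; exact: close_refl.
  by rewrite -E => -[_ /close_equiv]; apply.
apply/seteqP; split=> r [cr /close_equiv H]; split=> //; apply/close_equiv => //.
  by apply: (close_trans cq) => //; [exact: close_on_sym|exact: H].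
by apply: (close_trans cp) => //; exact: H.
Qed.

Lemma real_class_bigcup a q (T : Type) (g : qseq A -> set T) Z : condCauchy a q ->
  (forall p, condCauchy a p -> close a q p -> g p = Z) ->
  \bigcup_(p in real_class a q) g p = Z.
Proof.
move=> cq gZ; rewrite (_ : \bigcup_(p in real_class a q) g p = \bigcup_(p in
  real_class a q) Z).
  rewrite bigcup_const //; exists q; split=> //; apply/close_equiv => //.
  exact: close_refl.
by apply: eq_bigcupr => p [cp qp]; apply: gZ => //; apply/close_equiv.
Qed.

Lemma real_elts_class a q : condCauchy a q -> real_elts a (real_class a q).
Proof. by exists q. Qed.

Lemma real_gam a b q : condCauchy a q -> b <= a ->
  gam b (real_class a q : carrier (condReal A)) = real_class b q.
Proof.
move=> cq ba; apply: (real_class_bigcup cq) => p cp qp.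
apply/real_class_eq; [exact: condCauchy_sub cp|exact: condCauchy_sub cq|].
by apply: close_sub ba _ => //; exact: close_on_sym.
Qed.

Lemma real_glue (I : Type) (s : I -> A) (q : I -> qseq A) : partition_of \top s ->
  (forall i, condCauchy (s i) (q i)) ->
  exists2 Q, condCauchy \top Q & forall i, real_class (s i) Q = real_class (s i) (q i).
Proof.
move=> ps cq; have [Q [cQ HQ]] := cauchy_glue ps cq; exists Q => // i.
by apply/real_class_eq => //; [exact: condCauchy_sub cQ|exact: HQ].
Qed.

Lemma real_surj a q : condCauchy a q ->
  exists2 Q, condCauchy \top Q & real_class a Q = real_class a q.
Proof.
move=> cq; have cz := condCauchy_const (~` a) 0%R.
have [|Q cQ HQ] := @real_glue bool _ (fun i => if i then q else qseq_const 0%R)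
  (part_compl a).
  by case.
by exists Q => //; exact: HQ true.
Qed.

(** There is no nonzero condition below [\bot], so any two sequences are close there: this makes the
    set of reals over [\bot] a singleton. *)
Lemma dense_bot P : dense \bot P.
Proof. by move=> b /lt_le_trans H /H; rewrite ltxx. Qed.

Lemma condReal_set : is_condSet (condReal A).
Proof.
have c0 a := condCauchy_const a 0%R; split.
- exists (real_class \bot (qseq_const 0%R)); apply/seteqP; split=> [_ [q cq <-]|_ ->].
    apply/real_class_eq => //; move=> e e0; exact: dense_bot.
  exact: real_elts_class.
- move=> a _ [q cq <-]; rewrite (real_gam cq (lex1 a)); apply: real_elts_class.
  exact: condCauchy_sub cq.
- move=> a _ [q cq <-]; have [Q cQ <-] := real_surj cq.
  by exists (real_class \top Q); [exact: real_elts_class|exact: real_gam].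
- by move=> _ [q cq <-]; exact: real_gam.
- move=> a b _ _ [q cq <-] [p cp <-] ba; rewrite !(real_gam _ (lex1 _)) //.
  have cqa := condCauchy_sub (lex1 a) cq; have cpa := condCauchy_sub (lex1 a) cp.
  have cqb := condCauchy_sub (lex1 b) cq; have cpb := condCauchy_sub (lex1 b) cp.
  move=> /real_class_eq H; apply/real_class_eq => //.
  by apply: (close_sub cqa cpa ba); exact: H.
- move=> I s x ps xs.
  have /choice[q qP] : forall i, exists q,
    condCauchy (s i) q /\ real_class (s i) q = x i.
    by move=> i; have [q ? <-] := xs i; exists q.
  have [|Q cQ HQ] := real_glue ps (q := q); first by move=> i; have [] := qP i.
  exists (real_class \top Q); split.
    split; first exact: real_elts_class.
    by move=> i; rewrite (real_gam cQ (lex1 _)) HQ; have [_ ->] := qP i.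
  move=> _ [[p cp <-] H]; apply/real_class_eq => //;
    apply: (close_partition cQ cp ps) => i.
  apply/real_class_eq; [exact: condCauchy_sub cQ|exact: condCauchy_sub cp|].
  by rewrite HQ -(real_gam cp (lex1 _)) H; have [_ ->] := qP i.
Qed.

(** * Operations and order on classes of Cauchy sequences *)

Section RealOperations.
Context (a : A) (q p : qseq A) (cq : condCauchy a q) (cp : condCauchy a p).

Lemma pointwise_qadd :
  pointwise2 +%R (seq_at q a) (seq_at p a) (seq_at (qseq_add q p) a).
Proof. by apply: pointwise_map2; exact: condCauchy_fun. Qed.

Lemma pointwise_qmul :
  pointwise2 *%R (seq_at q a) (seq_at p a) (seq_at (qseq_mul q p) a).
Proof. by apply: pointwise_map2; exact: condCauchy_fun. Qed.

Lemma name_qadd : name a (seq_at (qseq_add q p) a).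
Proof.
move=> k; apply: part_seq_at.
exact: (seqfun_map2 _ (condCauchy_fun cq) (condCauchy_fun cp)).
Qed.

Lemma name_qmul : name a (seq_at (qseq_mul q p) a).
Proof.
move=> k; apply: part_seq_at.
exact: (seqfun_map2 _ (condCauchy_fun cq) (condCauchy_fun cp)).
Qed.

Lemma condCauchy_add : condCauchy a (qseq_add q p).
Proof.
apply/condCauchyP; split.
  exact: (seqfun_map2 _ (condCauchy_fun cq) (condCauchy_fun cp)).
apply: (cauchy_add (condCauchy_name cq) (condCauchy_name cp) name_qadd pointwise_qadd);
  exact: condCauchy_cauchy.
Qed.

Lemma condCauchy_mul : condCauchy a (qseq_mul q p).
Proof.
apply/condCauchyP; split.
  exact: (seqfun_map2 _ (condCauchy_fun cq) (condCauchy_fun cp)).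
apply: (cauchy_mul (condCauchy_name cq) (condCauchy_name cp) name_qmul pointwise_qmul);
  exact: condCauchy_cauchy.
Qed.

End RealOperations.

Lemma radd_class a q p : condCauchy a q -> condCauchy a p ->
  radd A a (real_class a q) (real_class a p) = real_class a (qseq_add q p).
Proof.
move=> cq cp; apply: (real_class_bigcup cq) => q' cq' qq'.
apply: (real_class_bigcup cp) => p' cp' pp'.
have cn := condCauchy_name; apply/real_class_eq; [exact: condCauchy_add..|].
apply: (close_add (cn _ _ cq') (cn _ _ cp') (name_qadd cq' cp') (cn _ _ cq) (cn _ _ cp)
  (name_qadd cq cp) (pointwise_qadd cq' cp') (pointwise_qadd cq cp));
  exact: close_on_sym.
Qed.

Lemma rmul_class a q p : condCauchy a q -> condCauchy a p ->
  rmul A a (real_class a q) (real_class a p) = real_class a (qseq_mul q p).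
Proof.
move=> cq cp; apply: (real_class_bigcup cq) => q' cq' qq'.
apply: (real_class_bigcup cp) => p' cp' pp'.
have cn := condCauchy_name; apply/real_class_eq; [exact: condCauchy_mul..|].
apply: (close_mul (cn _ _ cq') (cn _ _ cp') (name_qmul cq' cp') (cn _ _ cq) (cn _ _ cp)
  (name_qmul cq cp) (pointwise_qmul cq' cp') (pointwise_qmul cq cp));
  do ?[exact: condCauchy_cauchy|exact: close_on_sym].
Qed.

Definition leq_seq a (q p : qseq A) := le_on a (seq_at q a) (seq_at p a).

Definition ltq_seq a (q p : qseq A) := lt_on a (seq_at q a) (seq_at p a).

Lemma leq_seq_close a q p q' p' : condCauchy a q -> condCauchy a p ->
  close a q q' -> close a p p' -> leq_seq a q p -> leq_seq a q' p'.
Proof.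
move=> cq cp qq pp qp; apply: (le_on_trans (condCauchy_name cq)).
  exact/close_le_on/close_on_sym.
by apply: (le_on_trans (condCauchy_name cp) qp); exact: close_le_on.
Qed.

Lemma rle_class a q p : condCauchy a q -> condCauchy a p ->
  rle A a (real_class a q, real_class a p) <-> leq_seq a q p.
Proof.
move=> cq cp; split=> [[_ _ [q' [cq' qq'] [p' [cp' pp'] H]]]|H].
  have qq : close a q q' by apply/close_equiv.
  have pp : close a p p' by apply/close_equiv.
  have {}H : leq_seq a q' p' by apply/qseq_leP => //; exact: condCauchy_fun.
  by apply: (leq_seq_close cq' cp' _ _ H); exact: close_on_sym.
split; [exact: real_elts_class..|].
exists q; first by split=> //; apply/close_equiv => //; exact: close_refl.
exists p; first by split=> //; apply/close_equiv => //; exact: close_refl.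
by apply/qseq_leP => //; exact: condCauchy_fun.
Qed.

Lemma rleP a (x y : carrier (condReal A)) : rle A a (x, y) ->
  exists q p, [/\ condCauchy a q, condCauchy a p, x = real_class a q,
    y = real_class a p &
    leq_seq a q p].
Proof.
move=> H; have [/= [q cq qx] [p cp py] _] := H; exists q, p; split=> //.
by apply/rle_class => //; rewrite qx py.
Qed.

Lemma leq_seq_below a b q p : condCauchy a q -> condCauchy a p -> b <= a ->
  leq_seq b q p <-> le_on b (seq_at q a) (seq_at p a).
Proof.
move=> /condCauchy_fun fq /condCauchy_fun fp ba.
have sq := same_below_seq_at fq ba; have sp := same_below_seq_at fp ba.
by split; apply: le_on_same => //; exact: same_below_sym.
Qed.

Lemma leq_seq_sub a b q p : condCauchy a q -> condCauchy a p -> b <= a ->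
  leq_seq a q p -> leq_seq b q p.
Proof. by move=> cq cp ba H; apply/(leq_seq_below cq cp ba)/(le_on_sub ba). Qed.

Lemma leq_seq_partition a (I : Type) (s : I -> A) q p : condCauchy a q ->
  condCauchy a p ->
  partition_of a s -> (forall i, leq_seq (s i) q p) -> leq_seq a q p.
Proof.
move=> cq cp ps H; apply: (le_on_partition ps) => i.
by apply/(leq_seq_below cq cp (part_le ps i)).
Qed.

Lemma ltq_seq_below a b q p : condCauchy a q -> condCauchy a p -> b <= a ->
  ltq_seq b q p <-> lt_on b (seq_at q a) (seq_at p a).
Proof.
move=> /condCauchy_fun fq /condCauchy_fun fp ba.
have sq := same_below_seq_at fq ba; have sp := same_below_seq_at fp ba.
by split; apply: lt_on_same => //; exact: same_below_sym.
Qed.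

Lemma real_restricts a b q (y : carrier (condReal A)) : condCauchy a q -> b <= a ->
  restricts a b (real_class a q : carrier (condReal A)) y <-> y = real_class b q.
Proof.
move=> cq ba; split=> [[_ [p cp <-] []]|->].
  rewrite !(real_gam cp (lex1 _)) => /real_class_eq pq <-.
  have cpa := condCauchy_sub (lex1 a) cp.
  apply/real_class_eq; [exact: condCauchy_sub cp|exact: condCauchy_sub cq|].
  by apply: (close_sub cpa cq ba); exact: pq.
have [Q cQ HQ] := real_surj cq; exists (real_class \top Q);
  first exact: real_elts_class.
rewrite (real_gam cQ (lex1 _)) (real_gam cQ (lex1 _)); split=> //.
have cQa := condCauchy_sub (lex1 a) cQ.
by rewrite -(real_gam cQa ba) -(real_gam cq ba) HQ.
Qed.

(** Abstract strictness says only that [q <= p] and that the classes coincide on no nonzero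
    condition. [le_on_lt] turns this into separation by standard rationals, the form in which sums
    and products can be estimated. *)
Lemma rlt_class a q p : condCauchy a q -> condCauchy a p ->
  condLt (rle A) a (real_class a q) (real_class a p) <-> ltq_seq a q p.
Proof.
move=> cq cp; split=> [[/rle_class qp ne]|lt].
  apply: le_on_lt; do ?[exact: condCauchy_name|exact: condCauchy_cauchy|exact: qp].
  move=> b b0 ba /(close_below cq cp ba) H; move: b0.
  rewrite (ne b (real_class b q) ba) ?ltxx //; first by apply/real_restricts.
  apply/(real_restricts _ cp ba)/real_class_eq => //; exact: condCauchy_sub ba _.
split; first by apply/rle_class => //; exact: lt_on_le.
move=> b w ba /(real_restricts _ cq ba)-> /(real_restricts _ cp ba)/real_class_eq H.
apply/eqP/negPn/negP; rewrite -lt0x => b0.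
apply: (lt_on_not_close (condCauchy_name cq) (condCauchy_name cp) lt ba b0).
apply/(close_below cq cp ba)/H; exact: condCauchy_sub ba _.
Qed.

(** * The ordered field of conditional reals *)

Lemma rle_rel : is_condRel (rle A).
Proof.
have c0 := condCauchy_const \top 0%R.
apply: (condSubset_local (X := condProd (condReal A) (condReal A))
  (x0 := (rzero A, rzero A))).
- exact: condProd_set condReal_set condReal_set.
- by move=> a z [? ?].
- by apply/rle_class => //; apply: close_le_on; exact: close_refl.
- move=> a [x y] /rleP[q [p [cq cp -> -> qp]]].
  change (rle A a (gam a (real_class \top q : carrier (condReal A)),
    gam a (real_class \top p : carrier (condReal A)))).
  rewrite (real_gam cq (lex1 a)) (real_gam cp (lex1 a)).
  apply/rle_class; [exact: condCauchy_sub cq|exact: condCauchy_sub cp|].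
  exact: (leq_seq_sub cq cp (lex1 a)).
- move=> I s [x y] ps [/= [q cq <-] [p cp <-]] H; apply/rle_class => //.
  apply: (leq_seq_partition cq cp ps) => i; apply/rle_class;
    [exact: condCauchy_sub cq|exact: condCauchy_sub cp|].
  have : rle A (s i) (gam (s i) (real_class \top q : carrier (condReal A)),
    gam (s i) (real_class \top p : carrier (condReal A))) := H i.
  by rewrite (real_gam cq (lex1 _)) (real_gam cp (lex1 _)).
Qed.

Lemma rle_order : is_condPartialOrder (rle A).
Proof.
split; first exact: rle_rel.
- move=> _ [q cq <-]; apply/rle_class => //; apply: close_le_on; exact: close_refl.
- move=> x y /rleP[q [p [cq cp -> -> qp]]] /(rle_class cp cq) pq.
  by apply/real_class_eq => //; exact: le_on_anti.
- move=> x y z /rleP[q [p [cq cp -> -> qp]]] H.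
  have [_ /= [r cr rz] _] := H; move: H; rewrite -rz => /(rle_class cp cr) pr.
  by apply/rle_class => //; exact: (le_on_trans (condCauchy_name cp) qp).
Qed.

Lemma part_3 a b : (forall c, \bot < c -> c <= a -> c <= b -> False) ->
  partition_of \top (tnth [tuple a; b; ~` (a `|` b)]).
Proof.
move=> ab; have no c : \bot < c -> c <= a `|` b -> c <= ~` (a `|` b) -> False.
  move=> c0 c1 c2; have : c <= (a `|` b) `&` ~` (a `|` b) by rewrite lexI c1.
  by rewrite meetxC lex0 (gt_eqF c0).
apply/partitionP; split=> [i|c c0 _|c].
- exact: lex1.
- have split3 i : \bot < c `&` tnth [tuple a; b; ~` (a `|` b)] i ->
    exists g, [/\ \bot < g, g <= c & exists j, g <= tnth [tuple a; b; ~` (a `|` b)] j].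
    move=> m0; exists (c `&` tnth [tuple a; b; ~` (a `|` b)] i).
    by split; [|exact: leIl|exists i; exact: leIr].
  have [ca|ca] := eqVneq (c `&` a) \bot; last by apply: (split3 ord0); rewrite lt0x.
  have [cb|cb] := eqVneq (c `&` b) \bot.
    apply: (split3 (inord 2)); rewrite (tnth_nth \bot) inordK //= meet_l //.
    by rewrite complU lexI -!disj_leC ca cb eqxx.
  by apply: (split3 (inord 1)); rewrite (tnth_nth \bot) inordK //= lt0x.
- move=> [[|[|[|//]]] ?] [[|[|[|//]]] ?] c0; rewrite !(tnth_nth \bot) /= => ci cj;
    apply/val_inj => //=; exfalso.
  all: do ?[exact: (ab c)|exact: (no c c0 (le_trans ci (leUl _ _)))
    |exact: (no c c0 (le_trans ci (leUr _ _)))|exact: (no c c0 (le_trans cj (leUl _ _)))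
    |exact: (no c c0 (le_trans cj (leUr _ _)))].
Qed.

(** The first two conditions are the suprema of all conditions separating the sequences with the
    respective sign, the third is the complement of their join. If the sequences were not close on
    it, [not_close_on] would give a nonzero separating condition inside it, which also lies below
    the join. *)
Lemma rle_total : is_condTotalOrder (rle A).
Proof.
split; first exact: rle_order.
move=> _ _ [q cq <-] [p cp <-]; have nq := condCauchy_name cq;
  have np := condCauchy_name cp.
pose lo v u := sup [set c | lt_from v u c].
have lo_dense v u c : c <= lo v u -> lt_on c v u.
  move=> /le_sup_dense; apply: dense_imp => b _ _ [e He be]; exact: lt_from_sub He.
have lo_sub v u c : lt_from v u c -> c <= lo v u by move=> H; apply: le_sup.
pose a := lo (seq_at q \top) (seq_at p \top);
  pose b := lo (seq_at p \top) (seq_at q \top).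
have ab c : \bot < c -> c <= a -> c <= b -> False.
  move=> c0 /lo_dense qp /lo_dense pq;
    have [e [e0 ec [l [k [l0 H]]]]] := qp c c0 (lexx c).
  have [g [g0 ge [l' [k' [l'0 H']]]]] := pq e e0 ec.
  have [h [z [w [h0 hg hz hw zw]]]] :=
    holds_from_inhabited np nq g0 (lex1 g) (leq_maxr k k') H'.
  have := H _ h w z (leq_maxl k k') h0 (le_trans hg ge) hw hz; lra.
have real_lt c : c <= a -> condLt (rle A) c (real_class c q) (real_class c p).
  move=> ca; apply/rlt_class; [exact: condCauchy_sub cq|exact: condCauchy_sub cp|].
  by apply/(ltq_seq_below cq cp (lex1 c))/lo_dense.
have real_gt c : c <= b -> condLt (rle A) c (real_class c p) (real_class c q).
  move=> cb; apply/rlt_class; [exact: condCauchy_sub cp|exact: condCauchy_sub cq|].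
  by apply/(ltq_seq_below cp cq (lex1 c))/lo_dense.
exists a, b, (~` (a `|` b)); split.
- exact: part_3.
- by rewrite !(real_gam _ (lex1 _)) //; exact: real_lt.
- by rewrite !(real_gam _ (lex1 _)) //; exact: real_gt.
- rewrite !(real_gam _ (lex1 _)) //.
  apply/real_class_eq; [exact: condCauchy_sub cq|exact: condCauchy_sub cp|].
  apply/(close_below cq cp (lex1 _)); apply: contrapT.
  move=> /(not_close_on nq np (condCauchy_cauchy cq) (condCauchy_cauchy cp) (lex1 _)).
  move=> [c [c0 cab cl]]; have : c <= a `|` b.
    by case: cl => /lo_sub cl; [exact: le_trans (leUl _ _)|exact: le_trans (leUr _ _)].
  move=> cab'; have : c <= (a `|` b) `&` ~` (a `|` b) by rewrite lexI cab'.
  by rewrite meetxC lex0 (gt_eqF c0).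
Qed.

(** The tool for the algebraic identities: both sides take the value of one rational expression
    wherever the three sequences are decided. Identities in fewer variables repeat a sequence. *)
Lemma close_values a q p r L M (f : rat -> rat -> rat -> rat) :
  condCauchy a q -> condCauchy a p -> condCauchy a r -> condCauchy a L ->
    condCauchy a M ->
  (forall k c x y t, c <= seq_at q a k x -> c <= seq_at p a k y ->
    c <= seq_at r a k t ->
     c <= seq_at L a k (f x y t)) ->
  (forall k c x y t, c <= seq_at q a k x -> c <= seq_at p a k y ->
    c <= seq_at r a k t ->
     c <= seq_at M a k (f x y t)) ->
  real_class a L = real_class a M.
Proof.
move=> cq cp cr cL cM HL HM; apply/real_class_eq => //;
  apply: close_on_eq => k c z w c0 cz cw.
have cn := condCauchy_name; have ca := le_trans cz (name_le k z (cn _ _ cL)).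
have [x [b [b0 bc bx]]] := name_decide k (cn _ _ cq) c0 ca.
have [y [g [g0 gb gy]]] := name_decide k (cn _ _ cp) b0 (le_trans bc ca).
have [t [h [h0 hg ht]]] := name_decide k (cn _ _ cr) g0 (le_trans gb (le_trans bc ca)).
have hy := le_trans hg gy; have hx := le_trans hg (le_trans gb bx).
have hc := le_trans hg (le_trans gb bc).
rewrite (name_uniq (cn _ _ cL) h0 (le_trans hc cz) (HL _ _ _ _ _ hx hy ht)).
by rewrite (name_uniq (cn _ _ cM) h0 (le_trans hc cw) (HM _ _ _ _ _ hx hy ht)).
Qed.

Lemma seq_at_const_le a b z k : b <= a -> b <= seq_at (qseq_const z) a k z.
Proof. exact: gen_const_at. Qed.

Lemma condCauchy_opp a q : condCauchy a q -> condCauchy a (qseq_map (fun x => - x)%R q).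
Proof.
move=> cq; have fq := condCauchy_fun cq.
have fN := seqfun_map (fun x => - x)%R fq; apply/condCauchyP; split=> //.
exact: (cauchy_opp (condCauchy_name cq) (fun k => part_seq_at fN k)
  (pointwise_map _ fq) (condCauchy_cauchy cq)).
Qed.

Lemma radd_op : is_condOp (radd A).
Proof.
split=> [a [x y] /= [[q cq <-] [p cp <-]]|a [x y] [[/= q cq <-] [/= p cp <-]]].
  by rewrite radd_class //; apply: real_elts_class; exact: condCauchy_add.
have cqa := condCauchy_sub (lex1 a) cq; have cpa := condCauchy_sub (lex1 a) cp.
change (radd A a (gam a (real_class \top q : carrier (condReal A)))
  (gam a (real_class \top p : carrier (condReal A))) =
  gam a (radd A \top (real_class \top q) (real_class \top p))).
rewrite (real_gam cq (lex1 a)) (real_gam cp (lex1 a)) !radd_class //.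
by rewrite (real_gam (condCauchy_add cq cp) (lex1 a)).
Qed.

Lemma rmul_op : is_condOp (rmul A).
Proof.
split=> [a [x y] /= [[q cq <-] [p cp <-]]|a [x y] [[/= q cq <-] [/= p cp <-]]].
  by rewrite rmul_class //; apply: real_elts_class; exact: condCauchy_mul.
have cqa := condCauchy_sub (lex1 a) cq; have cpa := condCauchy_sub (lex1 a) cp.
change (rmul A a (gam a (real_class \top q : carrier (condReal A)))
  (gam a (real_class \top p : carrier (condReal A))) =
  gam a (rmul A \top (real_class \top q) (real_class \top p))).
rewrite (real_gam cq (lex1 a)) (real_gam cp (lex1 a)) !rmul_class //.
by rewrite (real_gam (condCauchy_mul cq cp) (lex1 a)).
Qed.

Lemma real_ring : is_condRing (radd A) (rmul A) (rzero A) (rone A).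
Proof.
have c0 := condCauchy_const \top 0%R; have c1 := condCauchy_const \top 1%R.
have ca := condCauchy_add; have cm := condCauchy_mul.
have v z k b : b <= seq_at (qseq_const z) \top k z by exact/seq_at_const_le/lex1.
split.
- exact: condReal_set.
- exact: radd_op.
- exact: rmul_op.
- exact: real_elts_class.
- exact: real_elts_class.
- move=> _ _ _ [q cq <-] [p cp <-] [r cr <-].
  have cqp := ca _ _ _ cq cp; have cpr := ca _ _ _ cp cr.
  rewrite !radd_class //.
  apply: (close_values (f := fun x y t => x + (y + t))%R cq cp cr (ca _ _ _ cq cpr)
    (ca _ _ _ cqp cr)).
    move=> k c x y t qx py rt; apply: (pointwise_qadd cq cpr) => //.
    exact: (pointwise_qadd cp cr).
  move=> k c x y t qx py rt; rewrite addrA; apply: (pointwise_qadd cqp cr) => //.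
  exact: (pointwise_qadd cq cp).
- move=> _ _ [q cq <-] [p cp <-]; rewrite !radd_class //.
  apply: (close_values (f := fun x y t => x + y)%R cq cp cp (ca _ _ _ cq cp) (ca _ _
    _ cp cq)).
    by move=> k c x y t qx py rt; exact: (pointwise_qadd cq cp).
  by move=> k c x y t qx py rt; rewrite addrC; exact: (pointwise_qadd cp cq).
- move=> _ [q cq <-]; rewrite /rzero radd_class //.
  apply: (close_values (f := fun x y t => x)%R cq cq cq (ca _ _ _ c0 cq) cq) => //.
  by move=> k c x y t qx _ _; rewrite -[x]add0r; exact: (pointwise_qadd c0 cq).
- move=> _ [q cq <-]; have cN := condCauchy_opp cq.
  exists (real_class \top (qseq_map (fun x => - x)%R q)); first exact: real_elts_class.
  rewrite radd_class //.
  apply: (close_values (f := fun x y t => 0)%R cq cq cq (ca _ _ _ cN cq) c0) => //.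
  move=> k c x y t qx _ _; rewrite -(addNr x); apply: (pointwise_qadd cN cq) => //.
  exact: (pointwise_map (fun x => - x)%R (condCauchy_fun cq)).
- move=> _ _ _ [q cq <-] [p cp <-] [r cr <-].
  have cqp := cm _ _ _ cq cp; have cpr := cm _ _ _ cp cr.
  rewrite !rmul_class //.
  apply: (close_values (f := fun x y t => x * (y * t))%R cq cp cr (cm _ _ _ cq cpr)
    (cm _ _ _ cqp cr)).
    move=> k c x y t qx py rt; apply: (pointwise_qmul cq cpr) => //.
    exact: (pointwise_qmul cp cr).
  move=> k c x y t qx py rt; rewrite mulrA; apply: (pointwise_qmul cqp cr) => //.
  exact: (pointwise_qmul cq cp).
- move=> _ [q cq <-]; rewrite /rone rmul_class //.
  apply: (close_values (f := fun x y t => x)%R cq cq cq (cm _ _ _ c1 cq) cq) => //.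
  by move=> k c x y t qx _ _; rewrite -[x]mul1r; exact: (pointwise_qmul c1 cq).
- move=> _ [q cq <-]; rewrite /rone rmul_class //.
  apply: (close_values (f := fun x y t => x)%R cq cq cq (cm _ _ _ cq c1) cq) => //.
  by move=> k c x y t qx _ _; rewrite -[x]mulr1; exact: (pointwise_qmul cq c1).
- move=> _ _ _ [q cq <-] [p cp <-] [r cr <-].
  have cqp := ca _ _ _ cq cp; have cqr := cm _ _ _ cq cr; have cpr := cm _ _ _ cp cr.
  rewrite (radd_class cq cp) !rmul_class // radd_class //.
  apply: (close_values (f := fun x y t => (x + y) * t)%R cq cp cr (cm _ _ _ cqp cr)
    (ca _ _ _ cqr cpr)).
    move=> k c x y t qx py rt; apply: (pointwise_qmul cqp cr) => //.
    exact: (pointwise_qadd cq cp).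
  move=> k c x y t qx py rt; rewrite mulrDl; apply: (pointwise_qadd cqr cpr).
    exact: (pointwise_qmul cq cr).
  exact: (pointwise_qmul cp cr).
- move=> _ _ _ [q cq <-] [p cp <-] [r cr <-].
  have cpr := ca _ _ _ cp cr; have cqp := cm _ _ _ cq cp; have cqr := cm _ _ _ cq cr.
  rewrite (radd_class cp cr) !rmul_class // radd_class //.
  apply: (close_values (f := fun x y t => x * (y + t))%R cq cp cr (cm _ _ _ cq cpr)
    (ca _ _ _ cqp cqr)).
    move=> k c x y t qx py rt; apply: (pointwise_qmul cq cpr) => //.
    exact: (pointwise_qadd cp cr).
  move=> k c x y t qx py rt; rewrite mulrDr; apply: (pointwise_qadd cqp cqr).
    exact: (pointwise_qmul cq cp).
  exact: (pointwise_qmul cq cr).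
Qed.

Lemma rmulC (x y : carrier (condReal A)) : condReal A \top x -> condReal A \top y ->
  rmul A \top x y = rmul A \top y x.
Proof.
move=> [q cq <-] [p cp <-]; rewrite !rmul_class //.
apply: (close_values (f := fun x y t => x * y)%R cq cp cp
  (condCauchy_mul cq cp) (condCauchy_mul cp cq)).
  by move=> k c z w t qz pw _; exact: (pointwise_qmul cq cp).
by move=> k c z w t qz pw _; rewrite mulrC; exact: (pointwise_qmul cp cq).
Qed.

(** Stated for an explicit representative because the subfield reuses it: the inverse of an embedded
    rational must be recognised as a class of termwise inverses. *)
Lemma real_inv q : condCauchy \top q ->
  (forall a, \bot < a -> gam a (real_class \top q : carrier (condReal A)) <> gam a
    (rzero A)) ->
  condCauchy \top (qseq_map GRing.inv q) /\
  rmul A \top (real_class \top q) (real_class \top (qseq_map GRing.inv q)) = rone A.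
Proof.
move=> cq q0; have c0 := condCauchy_const \top 0%R;
  have c1 := condCauchy_const \top 1%R.
have fq := condCauchy_fun cq; have nq := condCauchy_name cq.
have fi := seqfun_map GRing.inv fq; have pi := pointwise_map GRing.inv fq.
have aq : dense \top (apart_from (seq_at q \top)).
  apply: (not_zero_apart (condCauchy_name c0)) nq (condCauchy_cauchy cq) _.
    by move=> n c z; exact: seq_at_const.
  move=> b b0 _ /(close_below cq c0 (lex1 b)) H; apply: (q0 b b0).
  rewrite (real_gam cq (lex1 b)) (real_gam c0 (lex1 b)).
  by apply/real_class_eq; [exact: condCauchy_sub cq|exact: condCauchy_const|exact: H].
have ci : condCauchy \top (qseq_map GRing.inv q).
  apply/condCauchyP; split=> //.
  exact: (cauchy_inv nq (fun k => part_seq_at fi k) pi (condCauchy_cauchy cq) aq).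
split=> //; rewrite rmul_class //; apply/real_class_eq => //;
  first exact: condCauchy_mul.
apply: (close_mul_inv nq (condCauchy_name ci) (name_qmul cq ci) pi (pointwise_qmul cq
  ci) _ aq).
by move=> n c z; exact: seq_at_const.
Qed.

Lemma real_field : is_condOrderedField (radd A) (rmul A) (rzero A) (rone A) (rle A).
Proof.
have c0 := condCauchy_const \top 0%R; have cn := condCauchy_name; split.
- split; first exact: real_ring.
  move=> _ [q cq <-] q0; have [ci qi] := real_inv cq q0.
  have ei := real_elts_class ci.
  exists (real_class \top (qseq_map GRing.inv q)) => //; split=> //.
  by rewrite rmulC //; exact: real_elts_class.
- exact: rle_total.
- move=> _ _ _ [q cq <-] [p cp <-] [r cr <-] /(rlt_class cq cp) qp.
  rewrite !radd_class //; apply/rlt_class; [exact: condCauchy_add..|].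
  exact: (lt_on_add (cn _ _ cq) (cn _ _ cp) (cn _ _ cr) (name_qadd cq cr)
    (name_qadd cp cr) (pointwise_qadd cq cr) (pointwise_qadd cp cr) qp).
- move=> _ _ [q cq <-] [p cp <-] /(rlt_class c0 cq) q0 /(rlt_class c0 cp) p0.
  rewrite rmul_class //; apply/rlt_class => //; first exact: condCauchy_mul.
  apply: (lt_on_mul _ (cn _ _ cq) (cn _ _ cp) (name_qmul cq cp) (pointwise_qmul cq
    cp) q0 p0).
  by move=> n c z; exact: seq_at_const.
Qed.

(** * The embedding of the rationals *)

(** The constant sequence at [x], given by the constant name [gen_at x], since [x] is a conditional
    rational and [qseq_const] takes standard ones only. *)
Definition rat_embed a (x : carrier (condRat A)) : carrier (condReal A) :=
  real_class a (name_seq (fun=> gen_at x)).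

Section Embedding.
Context (a : A).
Implicit Types (x y : carrier (condRat A)).

Lemma seq_at_embed x k z : gen_elts a x ->
  seq_at (name_seq (fun=> gen_at x)) a k z = gen_at x z.
Proof. by move=> ex; apply: seq_at_name_seq => m; exact: part_gen_at. Qed.

Lemma condCauchy_embed x : gen_elts a x -> condCauchy a (name_seq (fun=> gen_at x)).
Proof.
move=> ex; apply/condCauchyP; split.
  by apply: seqfun_name_seq => m; exact: part_gen_at.
move=> e e0; apply: dense_all => b b0 ba; exists 0%N => m n c z w _ _ c0 cb.
rewrite !seq_at_embed // => cz cw.
by rewrite (part_uniq (part_gen_at ex) c0 cz cw) subrr normr0.
Qed.

Lemma rat_embed_eq x q : gen_elts a x -> condCauchy a q ->
  (forall k c z, c <= gen_at x z -> c <= seq_at q a k z) ->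
    rat_embed a x = real_class a q.
Proof.
move=> ex cq xq; have cx := condCauchy_embed ex.
apply: (close_values (f := fun z _ _ => z) cx cx cx cx cq) => // k c z w t.
by rewrite seq_at_embed // => cz _ _; exact: xq.
Qed.

Lemma rat_embed_const z : rat_embed a (gen_const a z) = real_class a (qseq_const z).
Proof.
have ez := gen_const_elts a z; apply: rat_embed_eq => //.
exact: condCauchy_const.
Qed.

Lemma rat_embed_inj x y : gen_elts a x -> gen_elts a y ->
  rat_embed a x = rat_embed a y -> x = y.
Proof.
move=> ex ey /real_class_eq H.
have {}H := H (condCauchy_embed ex) (condCauchy_embed ey).
apply: (gen_ext ex ey) => c z w c0 cz cw; apply: contrapT => zw.
(* Constant sequences never come closer than the distance of their values, so this distance, taken
   as the tolerance, refutes closeness. *)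
have e0 : (0 < `|z - w|)%R by rewrite normr_gt0 subr_eq0; apply/eqP.
have ca := le_trans cz (part_le (part_gen_at ex) z).
have [b [b0 bc [k Hk]]] := H _ e0 c c0 ca.
have := Hk k b z w (leqnn k) b0 (lexx b).
by rewrite !seq_at_embed // ltxx => /(_ (le_trans bc cz) (le_trans bc cw)).
Qed.

Lemma rat_embed_add x y : gen_elts a x -> gen_elts a y ->
  rat_embed a (qadd A a x y) = radd A a (rat_embed a x) (rat_embed a y).
Proof.
move=> ex ey; have cx := condCauchy_embed ex; have cy := condCauchy_embed ey.
have es : gen_elts a (qadd A a x y) by exact: gen_map2_elts.
rewrite radd_class //; apply: (close_values (f := fun z w _ => z + w)%R cx cy cy
  (condCauchy_embed es) (condCauchy_add cx cy)) => k c z w t.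
  by rewrite !seq_at_embed // => cz cw _; exact: gen_map2_at.
by move=> cz cw _; exact: (pointwise_qadd cx cy).
Qed.

Lemma rat_embed_mul x y : gen_elts a x -> gen_elts a y ->
  rat_embed a (qmul A a x y) = rmul A a (rat_embed a x) (rat_embed a y).
Proof.
move=> ex ey; have cx := condCauchy_embed ex; have cy := condCauchy_embed ey.
have es : gen_elts a (qmul A a x y) by exact: gen_map2_elts.
rewrite rmul_class //; apply: (close_values (f := fun z w _ => z * w)%R cx cy cy
  (condCauchy_embed es) (condCauchy_mul cx cy)) => k c z w t.
  by rewrite !seq_at_embed // => cz cw _; exact: gen_map2_at.
by move=> cz cw _; exact: (pointwise_qmul cx cy).
Qed.

Lemma rat_embed_le x y : gen_elts a x -> gen_elts a y ->
  qle A a (x, y) <-> rle A a (rat_embed a x, rat_embed a y).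
Proof.
move=> ex ey; have cx := condCauchy_embed ex; have cy := condCauchy_embed ey.
split=> [/gen_relP[_ _ xy]|/(rle_class cx cy) xy].
  apply/rle_class => // e e0; apply: dense_all => b b0 ba;
    exists 0%N => n c z w _ c0 cb.
  rewrite !seq_at_embed // => cz cw; have := xy c w z c0 cw cz; lra.
apply/gen_relP; split=> // c z w c0 cz cw; rewrite leNgt; apply/negP => wz.
have e0 : (0 < z - w)%R by rewrite subr_gt0.
have ca := le_trans cz (part_le (part_gen_at ex) z).
have [b [b0 bc [k Hk]]] := xy _ e0 c c0 ca.
have := Hk k b w z (leqnn k) b0 (lexx b).
by rewrite !seq_at_embed // opprB ltxx => /(_ (le_trans bc cw) (le_trans bc cz)).
Qed.

End Embedding.

Lemma rat_embed_gam a b (x : carrier (condRat A)) : gen_elts b x -> a <= b ->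
  rat_embed a (gam a x) = gam a (rat_embed b x).
Proof.
move=> ex ab; have cx := condCauchy_embed ex; rewrite (real_gam cx ab).
apply: rat_embed_eq; [exact: (gam_elts ex)|exact: (condCauchy_sub ab)|].
move=> k c z; rewrite (gam_at _ ex ab) (seq_at_restr (condCauchy_fun cx) _ _ ab).
by rewrite seq_at_embed.
Qed.

Lemma rat_embed_class a (x : carrier (condRat A)) : gen_elts a x ->
  real_elts a (rat_embed a x).
Proof. by move=> ex; apply/real_elts_class/condCauchy_embed. Qed.

(** For locality, rational preimages of the pieces are chosen and mixed into one conditional
    rational. Its image agrees with the given real on every piece, hence everywhere. *)
Lemma rat_embed_condSubset :
  @is_condSubset d A (condReal A) (fun a => rat_embed a @` condRat A a).
Proof.
apply: (condSubset_local (x0 := rzero A)).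
- exact: condReal_set.
- by move=> a _ [x ex <-]; exact: rat_embed_class.
- exists (gen_const \top 0%R); first exact: gen_const_elts.
  exact: rat_embed_const.
- move=> a _ [x ex <-]; exists (gam a x); first exact: gam_elts (lex1 a).
  exact: rat_embed_gam (lex1 a).
- move=> I s z ps [q cq <-] H.
  have /choice[x xP] : forall i, exists x : carrier (condRat A), gen_elts (s i) x /\
      rat_embed (s i) x = gam (s i) (real_class \top q : carrier (condReal A)).
    by move=> i; have [x ex xE] := H i; exists x.
  have px i : partition_of (s i) (gen_at (x i)) by have [/part_gen_at] := xP i.
  have pg := part_glue ps px; have eg := gen_mk_elts pg.
  exists (gen_mk \top (glue (fun i => gen_at (x i)))) => //.
  have cx := condCauchy_embed eg; apply/real_class_eq => //.
  apply: (close_partition cx cq ps) => i.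
  apply/real_class_eq; [exact: condCauchy_sub cx|exact: condCauchy_sub cq|].
  rewrite -(real_gam cx (lex1 _)) -(real_gam cq (lex1 _)); have [ei <-] := xP i.
  rewrite -(rat_embed_gam eg (lex1 (s i))); congr rat_embed.
  rewrite (gamE _ eg) -[RHS](gen_mkK ei); congr gen_mk; apply/funext => z'.
  by rewrite (gen_mk_at pg) (glue_restr i z' ps px).
Qed.

Lemma rat_subfield : is_condOrderedSubfield (radd A) (rmul A) (rzero A) (rone A) (rle A)
  (fun a => rat_embed a @` condRat A a).
Proof.
apply: condOrderedSubfield_closed.
- exact: real_field.
- exact: rat_embed_condSubset.
- exists (gen_const \top 0%R); first exact: gen_const_elts.
  exact: rat_embed_const.
- exists (gen_const \top 1%R); first exact: gen_const_elts.
  exact: rat_embed_const.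
- move=> a _ _ [x ex <-] [y ey <-]; exists (qadd A a x y); first exact: gen_map2_elts.
  exact: rat_embed_add.
- move=> a _ _ [x ex <-] [y ey <-]; exists (qmul A a x y); first exact: gen_map2_elts.
  exact: rat_embed_mul.
- move=> _ [x ex <-]; have eN : gen_elts \top (qopp \top x) by exact: gen_map_elts.
  have es : gen_elts \top (qadd A \top (qopp \top x) x) by exact: gen_map2_elts.
  exists (rat_embed \top (qopp \top x)); first by exists (qopp \top x).
  rewrite -rat_embed_add // /rzero -rat_embed_const; congr rat_embed.
  apply: (gen_ext es (gen_const_elts _ _)) => c z w c0 cz cw.
  have ez := gen_const_elts \top (0%R : rat).
  rewrite (part_uniq (part_gen_at ez) c0 cw (gen_const_at _ (lex1 c))).
  have [t [b [b0 bc bt]]] := part_decide (part_gen_at ex) c0 (lex1 c).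
  apply: (part_uniq (part_gen_at es) b0 (le_trans bc cz)).
  rewrite -(addNr t); apply: gen_map2_at => //; exact: gen_map_at.
- move=> _ [x ex <-] x0; have cx := condCauchy_embed ex.
  have [ci xi] := real_inv cx x0.
  pose y : carrier (condRat A) := gen_map (fun z : rat => z^-1 : rat)%R \top x.
  have ei : gen_elts \top y by exact: gen_map_elts.
  (* The real inverse is already rational: wherever [x] takes the value [z], both names take the
     value [z^-1]. *)
  have iE : rat_embed \top y =
      real_class \top (qseq_map GRing.inv (name_seq (fun=> gen_at x))).
    apply: (close_values (f := fun z _ _ => z^-1)%R cx cx cx (condCauchy_embed ei)
      ci) => k c z w t.
      by rewrite !seq_at_embed // => cz _ _;
        exact: (gen_map_at (fun z : rat => z^-1 : rat)%R).
    by move=> cz _ _; exact: (pointwise_map GRing.inv (condCauchy_fun cx)).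
  exists (rat_embed \top y); first by exists y.
  by rewrite iE; split=> //; rewrite rmulC //; exact: real_elts_class.
Qed.

Lemma rat_embed_iso : is_isoOntoSubfield (qadd A) (qmul A) (qle A)
  (radd A) (rmul A) (rzero A) (rone A) (rle A) rat_embed.
Proof.
split.
- split=> [a x ex|a x ex]; first exact: rat_embed_class.
  exact: rat_embed_gam (lex1 a).
- by move=> a x y /set_mem ex /set_mem ey; exact: rat_embed_inj.
- exact: rat_embed_add.
- exact: rat_embed_mul.
- exact: rat_embed_le.
- exact: rat_subfield.
Qed.

End ConditionalReals.

Theorem theorem4p3 (d : Order.disp_t) (A : ctbDistrLatticeType d)
    (Acomplete : order_complete A) (Anontrivial : (\bot : A)%O <> (\top : A)%O) :
  is_condOrderedField (radd A) (rmul A) (rzero A) (rone A) (rle A) /\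
  exists f : A -> carrier (condRat A) -> carrier (condReal A),
    is_isoOntoSubfield (qadd A) (qmul A) (qle A)
      (radd A) (rmul A) (rzero A) (rone A) (rle A) f.
Proof.
by split; [exact: real_field|exists (@rat_embed d A); exact: rat_embed_iso].
Qed.
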